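(* Let $I=\{1,2\}$ and let $A_\pm(z)=(A_+(z),A_-(z))\in\mathbb{Y}$ be one of the following six pairs: (1) $A_+(z)=\begin{pmatrix}1+z^2&-z\\-z&1+z^2\end{pmatrix}$, $A_-(z)=\begin{pmatrix}1+z^2&0\\0&1+z^2\end{pmatrix}$; (2) $A_+(z)=\begin{pmatrix}1+z^2&-z\\-z-z^5&1+z^6\end{pmatrix}$, $A_-(z)=\begin{pmatrix}1+z^2&0\\-z^3&1+z^6\end{pmatrix}$; (3) $A_+(z)=\begin{pmatrix}1+z^2&-z\\-z-z^5-z^9&1+z^{10}\end{pmatrix}$, $A_-(z)=\begin{pmatrix}1+z^2&0\\-z^3-z^7&1+z^{10}\end{pmatrix}$; (4) $A_+(z)=\begin{pmatrix}1+z^2&-z\\-z&1+z^2\end{pmatrix}$, $A_-(z)=\begin{pmatrix}1+z^2-z&0\\0&1+z^2-z\end{pmatrix}$; (5) $A_+(z)=\begin{pmatrix}1+z^2&-z\\-z-z^2&1+z^3\end{pmatrix}$, $A_-(z)=\begin{pmatrix}1+z^2-z&0\\0&1+z^3\end{pmatrix}$; (6) $A_+(z)=\begin{pmatrix}1+z^2&-z\\-z&1+z^2-z\end{pmatrix}$, $A_-(z)=\begin{pmatrix}1+z^2&0\\0&1+z^2\end{pmatrix}$. Let $\mu=\nu\circ\mu_{\boldsymbol i}$ be the associated sequence of mutations (together with the permutation) $(B,\boldsymbol y(0))\to(B,\boldsymbol y(1))$. Then $$\mathbb{E}(\mu^{h_+})=\mathbb{E}(\mu^{-h_-}).$$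
   Context: **Pairs.** Let $I$ be a finite set, $\mathbb{N}=\{0,1,2,\dots\}$, $[n]_+=\max(0,n)$. $\mathbb{Y}_0$ is the set of pairs $(\boldsymbol r,\boldsymbol n)$ of families of integers $\boldsymbol r=(r_i)_{i\in I}$, $\boldsymbol n=(n_{ij;p})_{i,j\in I,p\in\mathbb{N}}$ with $r_i\ge1$ and $n_{ij;p}=0$ unless $0<p<r_i$. Put $n^\pm_{ij;p}=[\pm n_{ij;p}]_+$ and $$A_\pm(z)=\operatorname{diag}(1+z^{r_i})_{i\in I}-\Bigl(\sum_{p\in\mathbb{N}}n^\pm_{ij;p}z^p\Bigr)_{i,j\in I}.$$ The map $(\boldsymbol r,\boldsymbol n)\mapsto A_\pm(z)$ is injective, and $\mathbb{Y}_0$ is identified with its image. $\mathbb{Y}\subseteq\mathbb{Y}_0$ is the subset of pairs with $A_+(z)A_-(z^{-1})^{\mathsf T}=A_-(z)A_+(z^{-1})^{\mathsf T}$. **Y-seeds and mutations.** A semifield is a multiplicative abelian group with an addition that is commutative, associative, and distributive with respect to multiplication. A Y-seed (with finite index set $R$, in a semifield $\mathbb{P}$) is a pair $(B,\boldsymbol y)$ of a skew-symmetric integer matrix $B=(B_{ij})_{i,j\in R}$ and a tuple $\boldsymbol y=(y_i)_{i\in R}$ in $\mathbb{P}$. For $k\in R$, $\mu_k(B,\boldsymbol y)=(B',\boldsymbol y')$ with $B'_{ij}=-B_{ij}$ if $i=k$ or $j=k$, $B'_{ij}=B_{ij}+[-B_{ik}]_+B_{kj}+B_{ik}[B_{kj}]_+$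 otherwise; $y'_k=y_k^{-1}$ and $y'_i=y_iy_k^{[B_{ki}]_+}(1+y_k)^{-B_{ki}}$ for $i\ne k$. Mutations $\mu_i,\mu_j$ commute if $B_{ij}=0$; for a set $\boldsymbol i$ with $B_{ij}=0$ for all $i,j\in\boldsymbol i$, $\mu_{\boldsymbol i}$ is the composite of the $\mu_i$, $i\in\boldsymbol i$ (in any order). For a bijection $\nu:R\to R$, $\nu(B,\boldsymbol y)=(B',\boldsymbol y')$ with $B'_{\nu(i)\nu(j)}=B_{ij}$, $y'_{\nu(i)}=y_i$. **The sequence attached to $A_\pm(z)$.** Let $R=\{(i,u)\in I\times\mathbb{Z}\mid0\le u<r_i\}$, $\boldsymbol i=\{(i,u)\in R\mid u=0\}$, $\nu(i,p)=(i,p-1)$ if $p>0$, $\nu(i,0)=(i,r_i-1)$, and $$B_{(i,p)(j,q)}=-n_{ij;p-q}+n_{ji;q-p}+\sum_{k\in I}\sum_{v=0}^{\min(p,q)}\bigl(n^+_{ik;p-v}n^-_{jk;q-v}-n^-_{ik;p-v}n^+_{jk;q-v}\bigr),$$ with $n_{ij;p}=n^\pm_{ij;p}=0$ for $p<0$. Then $B$ is skew-symmetric and $\nu(\mu_{\boldsymbol i}(B))=B$. The tropical semifield $\operatorname{Trop}(\boldsymbol y)$ is the free multiplicative abelian group on $\boldsymbol y=(y_r)_{r\in R}$ with addition $\prod_ry_r^{a_r}+\prod_ry_r^{b_r}=\prod_ry_r^{\min(a_r,b_r)}$. The tuples $\boldsymbol y(u)$, $u\in\mathbb{Z}$, in $\operatorname{Trop}(\boldsymbol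 y)$ are defined by $\boldsymbol y(0)=\boldsymbol y$ and $(B,\boldsymbol y(u+1))=\nu(\mu_{\boldsymbol i}(B,\boldsymbol y(u)))$. **The numbers $h_\pm$.** $h_+$ (resp. $h_-$) is the least positive integer $u$ such that for every $r\in R$ all exponents in the monomial $y_r(u)$ (resp. $y_r(-u)$) of $\operatorname{Trop}(\boldsymbol y)$ are nonpositive. For the six pairs these exist, and $(h_+,h_-)$ is given by: (1) $(3,2)$; (2) $(8,6)$; (3) $(18,10)$; (4) $(3,3)$; (5) $(5,3)$; (6) $(5,2)$. **The quantity $\mathbb{E}$.** Let $\lambda$ be the skew-symmetric bilinear form on $\mathbb{Z}^R$ with $\lambda(e_r,e_s)=-B_{rs}$ for the standard basis $(e_r)_{r\in R}$. Let $\widehat{\mathbb{A}}$ be the completed quantum affine space: formal (possibly infinite) $\mathbb{Q}(q^{1/2})$-linear combinations of symbols $Y^\alpha$, $\alpha\in\mathbb{N}^R$, with product $Y^\alpha Y^\beta=q^{\frac12\lambda(\alpha,\beta)}Y^{\alpha+\beta}$. The quantum dilogarithm is $$\mathbf{E}(x)=1+\sum_{n\ge1}\frac{q^{n^2/2}\,x^n}{(q^n-1)(q^n-q)\cdots(q^n-q^{n-1})}\in\mathbb{Q}(q^{1/2})[[x]].$$ Consider a finite sequence of mutations and relabelings starting from the Y-seed $(B,\boldsymbol y)$ in $\operatorname{Trop}(\boldsymbol y)$, with mutations performed at vertices $k_1,k_2,\dots,k_N$ in this order. Let $\prod_ry_r^{(\beta_t)_r}$ be the $y$-variable at the vertex $k_t$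 just before the $t$-th mutation; by sign-coherence there is a unique $\varepsilon_t\in\{1,-1\}$ with $\varepsilon_t\beta_t\in\mathbb{N}^R\setminus\{0\}$. Then $$\mathbb{E}=\mathbf{E}(Y^{\varepsilon_1\beta_1})^{\varepsilon_1}\,\mathbf{E}(Y^{\varepsilon_2\beta_2})^{\varepsilon_2}\cdots\mathbf{E}(Y^{\varepsilon_N\beta_N})^{\varepsilon_N}\in\widehat{\mathbb{A}}.$$ $\mathbb{E}(\mu^{h_+})$ is this element for the sequence $(B,\boldsymbol y(0))\to(B,\boldsymbol y(1))\to\cdots\to(B,\boldsymbol y(h_+))$, each step being $\mu_{\boldsymbol i}$ followed by relabeling by $\nu$; $\mathbb{E}(\mu^{-h_-})$ is this element for the sequence $(B,\boldsymbol y(0))\to(B,\boldsymbol y(-1))\to\cdots\to(B,\boldsymbol y(-h_-))$, each step being relabeling by $\nu^{-1}$ followed by $\mu_{\boldsymbol i}$. *)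

(* Defs.v *)
From HB Require Import structures.
From mathcomp Require Import all_boot all_order all_fingroup all_algebra.
From mathcomp Require Import boolp functions ring.

Set Implicit Arguments.
Unset Strict Implicit.
Unset Printing Implicit Defensive.

Import Order.TTheory GRing.Theory Num.Theory.
Local Open Scope ring_scope.

Definition pospart (n : int) : int := Num.max 0 n.

Record Y0 (m : nat) := MkY0 {
  rr : 'I_m -> nat;
  nn : 'I_m -> 'I_m -> nat -> int;
  rr_ge1 : forall i, (1 <= rr i)%N;
  nn_supp : forall i j p, ~~ (0 < p < rr i)%N -> nn i j p = 0 }.

Section Pairs.
Variables (m : nat) (P : Y0 m).

Definition nplus i j p : int := pospart (nn P i j p).
Definition nminus i j p : int := pospart (- nn P i j p).

(* By nn_supp the sums over all p are sums over p < r_i. *)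
Definition Aplus : 'M[{poly int}]_m :=
  diag_mx (\row_i (1 + 'X^(rr P i)))
  - \matrix_(i, j) \poly_(p < rr P i) nplus i j p.
Definition Aminus : 'M[{poly int}]_m :=
  diag_mx (\row_i (1 + 'X^(rr P i)))
  - \matrix_(i, j) \poly_(p < rr P i) nminus i j p.

End Pairs.

(* A(x) for x in the fraction field Q(z) of Z[z], which contains the Laurent polynomials. *)
Definition evalA (m : nat) (A : 'M[{poly int}]_m) (x : {fraction {poly int}}) :
    'M[{fraction {poly int}}]_m :=
  map_mx (fun p => (map_poly intr p).[x]) A.

Definition zvar : {fraction {poly int}} := tofrac 'X.

Definition inY (m : nat) (P : Y0 m) : Prop :=
  evalA (Aplus P) zvar *m (evalA (Aminus P) zvar^-1)^T =
  evalA (Aminus P) zvar *m (evalA (Aplus P) zvar^-1)^T.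

(* The multiplicative group is a zmodType, hence written additively: the
   product is x + y, the unit 0, the inverse - x and the n-th power x *~ n.
   The addition of the semifield is sadd. *)
Record semifield := MkSemifield {
  smul :> zmodType;
  sadd : smul -> smul -> smul;
  saddC : commutative sadd;
  saddA : associative sadd;
  smul_saddr : forall x y z, x + sadd y z = sadd (x + y) (x + z) }.

Record Yseed (R : finType) (S : semifield) := MkYseed {
  sB : R -> R -> int;
  sy : R -> S;
  sB_skew : forall i j, sB i j = - sB j i }.

Section Mutation.
Variables (R : finType) (S : semifield).
Implicit Types (k : R) (s : Yseed R S) (nu : {perm R}).

Definition mutB k (B : R -> R -> int) (i j : R) : int :=
  if (i == k) || (j == k) then - B i j
  else B i j + pospart (- B i k) * B k j + B i k * pospart (B k j).

(* 0 is the unit element 1 of the semifield, so sadd 0 (y k) is 1 + y_k. *)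
Definition muty k (B : R -> R -> int) (y : R -> S) (i : R) : S :=
  if i == k then - y k
  else y i + y k *~ pospart (B k i) + sadd 0 (y k) *~ (- B k i).

Lemma mutB_skew k (B : R -> R -> int) :
  (forall i j, B i j = - B j i) -> forall i j, mutB k B i j = - mutB k B j i.
Proof.
move=> Bsk i j; rewrite /mutB orbC (Bsk i j); case: ifP => // _.
by rewrite (Bsk j k) (Bsk k i) !opprK; ring.
Qed.

Definition mu k s : Yseed R S :=
  MkYseed (muty k (sB s) (sy s)) (mutB_skew k (@sB_skew _ _ s)).

Definition relabel nu s : Yseed R S :=
  @MkYseed R S (fun i j => sB s ((nu^-1)%g i) ((nu^-1)%g j))
    (fun i => sy s ((nu^-1)%g i)) (fun i j => sB_skew s _ _).

Inductive op := Mut of R | Relabel of {perm R}.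

Definition apply_op s (o : op) : Yseed R S :=
  match o with Mut k => mu k s | Relabel nu => relabel nu s end.

Definition run s (ops : seq op) : Yseed R S := foldl apply_op s ops.

End Mutation.

Section Trop.
Variable R : finType.

(* Monomials are given by their exponent vectors. *)
Definition tropadd (a b : {ffun R -> int}) : {ffun R -> int} :=
  [ffun r => Num.min (a r) (b r)].

Lemma tropaddC : commutative tropadd.
Proof. by move=> a b; apply/ffunP => r; rewrite !ffunE minC. Qed.

Lemma tropaddA : associative tropadd.
Proof. by move=> a b c; apply/ffunP => r; rewrite !ffunE minA. Qed.

Lemma tropaddDr a b c : a + tropadd b c = tropadd (a + b) (a + c).
Proof. by apply/ffunP => r; rewrite !ffunE addr_minr. Qed.

Definition Trop : semifield := MkSemifield tropaddC tropaddA tropaddDr.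

Definition tropvar (r : R) : Trop := [ffun s => (s == r)%:R].

End Trop.

Section Attached.
Variables (m : nat) (P : Y0 m).

Definition RR : finType := {i : 'I_m & 'I_(rr P i)}.

Definition ri (x : RR) : 'I_m := tag x.
Definition rp (x : RR) : nat := tagged x.

Definition nnZ i j (p : int) : int := if p is Posz k then nn P i j k else 0.

Definition BB (x y : RR) : int :=
  let (i, p) := (ri x, rp x) in let (j, q) := (ri y, rp y) in
  - nnZ i j (p%:Z - q%:Z) + nnZ j i (q%:Z - p%:Z)
  + \sum_k \sum_(v < (minn p q).+1)
      (nplus P i k (p - v) * nminus P j k (q - v)
       - nminus P i k (p - v) * nplus P j k (q - v)).

Lemma BB_skew x y : BB x y = - BB y x.
Proof.
rewrite /BB minnC !opprD opprK -sumrN [in RHS](addrC (nnZ _ _ _)).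
congr (_ + _); apply: eq_bigr => k _; rewrite -sumrN; apply: eq_bigr => v _.
by rewrite opprB mulrC [X in _ - X]mulrC.
Qed.

Definition bfi : {set RR} := [set x | rp x == 0%N].

(* ord_pred is the predecessor p |-> p - 1, with 0 |-> r_i - 1. *)
Definition nuf (x : RR) : RR :=
  @Tagged _ (ri x) (fun i => 'I_(rr P i)) (ord_pred (tagged x)).

Lemma nuf_inj : injective nuf.
Proof.
apply: (can_inj (g := fun x : RR =>
  @Tagged _ (ri x) (fun i => 'I_(rr P i)) (ordS (tagged x)))).
by case=> i p; rewrite /nuf /= ord_predK.
Qed.

Definition nu : {perm RR} := perm nuf_inj.

Definition init : Yseed RR (Trop RR) := MkYseed (@tropvar RR) BB_skew.

(* nu o mu_i and its inverse mu_i o nu^-1; the entries of BB between elements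
   of bfi vanish, so the order in which enum lists bfi is immaterial. *)
Definition fwd : seq (op RR) := rcons [seq Mut k | k <- enum bfi] (Relabel nu).
Definition bwd : seq (op RR) :=
  Relabel (nu^-1)%g :: [seq Mut k | k <- enum bfi].

Definition mupow (u : int) : seq (op RR) :=
  match u with
  | Posz k => flatten (nseq k fwd)
  | Negz k => flatten (nseq k.+1 bwd)
  end.

Definition yy (u : int) : RR -> Trop RR := sy (run init (mupow u)).

Definition all_nonpos (u : int) : bool :=
  [forall x, forall s, (yy u x : {ffun RR -> int}) s <= 0].

End Attached.

(* The least positive u satisfying Q, or 0 if there is none. *)
Definition least_pos (Q : pred nat) : nat :=
  if pselect (exists u, (0 < u)%N && Q u) is left ex then ex_minn ex else 0%N.

Definition hplus (m : nat) (P : Y0 m) : nat :=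
  least_pos (fun u => all_nonpos P u%:Z).
Definition hminus (m : nat) (P : Y0 m) : nat :=
  least_pos (fun u => all_nonpos P (- u%:Z)).

(* Q(q^(1/2)), as the rational functions in qh = q^(1/2) *)
Definition KK : fieldType := {fraction {poly rat}}.
Definition qh : KK := tofrac 'X.
Definition q : KK := qh ^+ 2.

Definition lambda (R : finType) (B : R -> R -> int) (a b : {ffun R -> nat}) :
    int :=
  \sum_r \sum_s (a r)%:Z * (b s)%:Z * - B r s.

(* A formal linear combination of the Y^c is its family of coefficients. *)
Definition qaff (R : finType) (B : R -> R -> int) : Type :=
  {ffun R -> nat} -> KK.

HB.instance Definition _ R B := GRing.Zmodule.on (@qaff R B).

Section QuantumAffine.
Variables (R : finType) (B : R -> R -> int).
Implicit Types (a b c : {ffun R -> nat}) (f g h : qaff B).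

Definition coef c f : KK := f c.

Definition Ymon a : qaff B := fun c => (c == a)%:R.

Definition deg c : nat := (\sum_r c r)%N.
Arguments deg c%_R.

Definition box (N : nat) := {ffun R -> 'I_N}.
Definition unbox N (a : box N) : {ffun R -> nat} := [ffun r => a r : nat].

(* Bounding the entries of a and b by those of the box makes the sum over all
   pairs with a + b = c finite. *)
Definition qmul f g : qaff B := fun c =>
  \sum_(p : box (deg c).+1 * box (deg c).+1 | unbox p.1 + unbox p.2 == c)
    qh ^ lambda B (unbox p.1) (unbox p.2) * (f (unbox p.1) * g (unbox p.2)).


Lemma unbox_inj N : injective (@unbox N).
Proof.
move=> a b /ffunP ab; apply/ffunP => r; apply: val_inj.
by have := ab r; rewrite !ffunE.
Qed.

Lemma unbox_onto N c : (forall r, (c r < N)%N) -> exists a : box N, unbox a = c.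
Proof.
move=> cN; exists [ffun r => Ordinal (cN r)].
by apply/ffunP => r; rewrite !ffunE.
Qed.

Lemma deg_ge c r : (c r <= deg c)%N.
Proof. by rewrite /deg (bigD1 r) //= leq_addr. Qed.

Lemma degD a b : deg (a + b) = (deg a + deg b)%N.
Proof. by rewrite /deg -big_split; apply: eq_bigr => r _; rewrite ffunE. Qed.

Lemma leq_degl a b c : a + b = c -> (deg a <= deg c)%N.
Proof. by move=> <-; rewrite degD leq_addr. Qed.

Lemma leq_degr a b c : a + b = c -> (deg b <= deg c)%N.
Proof. by move=> <-; rewrite degD leq_addl. Qed.

Lemma expD_inj a : injective (+%R a).
Proof.
move=> b c /ffunP bc; apply/ffunP => r; have := bc r.
by rewrite !ffunE => /addnI.
Qed.

Lemma deg_eq0 c : (deg c == 0)%N = (c == 0).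
Proof.
rewrite /deg sum_nat_eq0; apply/forallP/eqP => [c0|-> r]; last by rewrite ffunE.
by apply/ffunP => r; rewrite ffunE; apply/eqP/c0.
Qed.

Lemma ltn_degr a b c : a != 0 -> a + b = c -> (deg b < deg c)%N.
Proof. by move=> a0 <-; rewrite degD -[ltnLHS]add0n ltn_add2r lt0n deg_eq0. Qed.

Lemma deg0 : deg 0 = 0%N.
Proof. by apply/eqP; rewrite deg_eq0. Qed.

Lemma lt_deg c N r : (deg c < N)%N -> (c r < N)%N.
Proof. exact/leq_ltn_trans/deg_ge. Qed.

Lemma big_box N c (F : {ffun R -> nat} -> KK) : (deg c < N)%N ->
  \sum_(a : box N | unbox a == c) F (unbox a) = F c.
Proof.
move=> cN; have [r|a <-] := @unbox_onto N c; first exact: lt_deg.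
rewrite (bigD1 a) //= big1 ?addr0 // => b /andP[/eqP/unbox_inj -> /eqP].
by case.
Qed.


Definition rebox N M (a : box N) : box M.+1 := [ffun r => inord (a r)].

Lemma unbox_rebox N M (a : box N) : (forall r, (a r < M.+1)%N) ->
  unbox (rebox M a) = unbox a.
Proof. by move=> aM; apply/ffunP => r; rewrite !ffunE inordK. Qed.

Lemma reboxK N M (a : box N.+1) :
  (rebox N (rebox M a) == a) = [forall r, (a r < M.+1)%N].
Proof.
apply/eqP/forallP => [aa r|aM].
  have /(congr1 (fun f : box N.+1 => val (f r))) := aa.
  rewrite !ffunE /=; case: (ltnP (a r) M.+1) => // Mr.
  rewrite /inord /insubd [insub (a r : nat)]insubN -?leqNgt //= insubT //=.
  by move=> a0; rewrite -a0 in Mr.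
by apply: unbox_inj; rewrite !unbox_rebox // => r; rewrite ffunE inordK.
Qed.

Lemma qmul_box N f g c : (deg c < N)%N ->
  qmul f g c = \sum_(p : box N * box N | unbox p.1 + unbox p.2 == c)
    qh ^ lambda B (unbox p.1) (unbox p.2) * (f (unbox p.1) * g (unbox p.2)).
Proof.
case: N => // N; rewrite ltnS => cN; rewrite /qmul.
have small (M K : nat) (a b : box K) : (deg c <= M)%N ->
    unbox a + unbox b == c -> [forall r, (a r < M.+1)%N].
  move=> cM /eqP abc; apply/forallP => r; rewrite ltnS.
  apply: leq_trans cM; apply: leq_trans (deg_ge c r).
  by rewrite -abc !ffunE; apply: leq_addr.
have small2 (M K : nat) (a b : box K) : (deg c <= M)%N ->
    unbox a + unbox b == c -> [forall r, (b r < M.+1)%N].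
  by move=> cM; rewrite addrC; apply: small.
rewrite [RHS](reindex_onto (fun p => (rebox N p.1, rebox N p.2))
  (fun p => (rebox (deg c) p.1, rebox (deg c) p.2))) /=; last first.
  move=> [a b] /= abc; congr (_, _); apply/eqP; rewrite reboxK.
    exact: small abc.
  exact: small2 abc.
apply: eq_big => [[a b]|[a b] abc] /=; last first.
  rewrite !unbox_rebox //; first exact/forallP/(small2 N _ _ _ cN abc).
  exact/forallP/(small N _ _ _ cN abc).
rewrite -pair_eqE /pair_eq /= !reboxK; apply/idP/idP => [abc|].
  rewrite (small N _ _ _ cN abc) (small2 N _ _ _ cN abc) !unbox_rebox ?abc //.
    exact/forallP/(small2 N _ _ _ cN abc).
  exact/forallP/(small N _ _ _ cN abc).
by case/and3P => abc /forallP aN /forallP bN; rewrite !unbox_rebox in abc.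
Qed.

Lemma lambdaDl a b c : lambda B (a + b) c = lambda B a c + lambda B b c.
Proof.
rewrite /lambda -big_split; apply: eq_bigr => r _ /=.
rewrite -big_split; apply: eq_bigr => s _ /=.
by rewrite ffunE PoszD; ring.
Qed.

Lemma lambdaDr a b c : lambda B a (b + c) = lambda B a b + lambda B a c.
Proof.
rewrite /lambda -big_split; apply: eq_bigr => r _ /=.
rewrite -big_split; apply: eq_bigr => s _ /=.
by rewrite ffunE PoszD; ring.
Qed.

Lemma lambda0l a : lambda B 0 a = 0.
Proof. by apply/(addrI (lambda B 0 a)); rewrite -lambdaDl !addr0. Qed.

Lemma lambda0r a : lambda B a 0 = 0.
Proof. by apply/(addrI (lambda B a 0)); rewrite -lambdaDr !addr0. Qed.

Lemma qh_neq0 : qh != 0.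
Proof. by rewrite /qh tofrac_eq0 polyX_eq0. Qed.

Lemma qmulA : associative qmul.
Proof.
move=> f g h; apply/funext => c; pose N := (deg c).+1.
have cN : (deg c < N)%N by [].
pose T a b d := qh ^ (lambda B a b + lambda B a d + lambda B b d)
  * (f a * g b * h d).
transitivity (\sum_(a : box N) \sum_(s : box N * box N |
    unbox a + (unbox s.1 + unbox s.2) == c)
    T (unbox a) (unbox s.1) (unbox s.2)).
  rewrite (qmul_box _ _ cN) -(pair_big_dep xpredT
    (fun a d : box N => unbox a + unbox d == c) (fun a d : box N =>
    qh ^ lambda B (unbox a) (unbox d) * (f (unbox a) * qmul g h (unbox d)))) /=.
  apply: eq_bigr => a _.
  transitivity (\sum_(d : box N | unbox a + unbox d == c)
      \sum_(s : box N * box N | unbox s.1 + unbox s.2 == unbox d)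
      T (unbox a) (unbox s.1) (unbox s.2)).
    apply: eq_bigr => d /eqP ad; rewrite (@qmul_box N); last first.
      by rewrite ltnS -ad degD leq_addl.
    rewrite !mulr_sumr; apply: eq_bigr => s /eqP <-.
    rewrite lambdaDr /T !expfzDr ?qh_neq0 //; ring.
  rewrite (exchange_big_dep (fun s : box N * box N =>
    unbox a + (unbox s.1 + unbox s.2) == c)) /=; last by move=> d s ? /eqP ->.
  apply: eq_bigr => s asc.
  rewrite -[RHS](big_box (fun=> T (unbox a) (unbox s.1) (unbox s.2))
    (_ : (deg (unbox s.1 + unbox s.2) < N)%N)); last first.
    by rewrite ltnS -(eqP asc) [X in (_ <= X)%N]degD leq_addl.
  by apply: eq_bigl => d; rewrite andbC [X in X && _]eq_sym; case: eqP => // ->.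
transitivity (\sum_(d : box N) \sum_(s : box N * box N |
    (unbox s.1 + unbox s.2) + unbox d == c)
    T (unbox s.1) (unbox s.2) (unbox d)).
  transitivity (\sum_(a : box N) \sum_(b : box N) \sum_(d : box N |
     unbox a + unbox b + unbox d == c) T (unbox a) (unbox b) (unbox d)).
    apply: eq_bigr => a _; rewrite (pair_big_dep xpredT
     (fun b d : box N => unbox a + unbox b + unbox d == c)) /=.
    by apply: eq_bigl => s; rewrite addrA.
  rewrite pair_big /= (exchange_big_dep xpredT) //=.
rewrite (qmul_box _ _ cN) -(pair_big_dep xpredT
  (fun a d : box N => unbox a + unbox d == c) (fun a d : box N =>
  qh ^ lambda B (unbox a) (unbox d) * (qmul f g (unbox a) * h (unbox d)))) /=.
rewrite [RHS](exchange_big_dep xpredT) //=; apply: eq_bigr => d _.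
transitivity (\sum_(a : box N | unbox a + unbox d == c)
    \sum_(s : box N * box N | unbox s.1 + unbox s.2 == unbox a)
    T (unbox s.1) (unbox s.2) (unbox d)); last first.
  apply: eq_bigr => a /eqP ad; rewrite (@qmul_box N f g); last first.
    by rewrite ltnS -ad degD leq_addr.
  rewrite mulr_suml mulr_sumr; apply: eq_bigr => s /eqP <-.
  rewrite lambdaDl /T -addrA !expfzDr ?qh_neq0 //; ring.
rewrite [RHS](exchange_big_dep (fun s : box N * box N =>
  unbox s.1 + unbox s.2 + unbox d == c)) /=; last by move=> a s ? /eqP ->.
apply: eq_bigr => s asc.
rewrite -[LHS](big_box (fun=> T (unbox s.1) (unbox s.2) (unbox d))
  (_ : (deg (unbox s.1 + unbox s.2) < N)%N)); last first.
  by rewrite ltnS -(eqP asc) [X in (_ <= X)%N]degD leq_addr.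
by apply: eq_bigl => a; rewrite andbC [X in X && _]eq_sym; case: eqP => // ->.
Qed.

Lemma qmul_Ymonl a f c : qmul (Ymon a) f (a + c) = qh ^ lambda B a c * f c.
Proof.
pose N := (deg (a + c)).+1; have lt_acN : (deg (a + c) < N)%N by [].
have [r|a' a'E] := @unbox_onto N a.
  by apply: lt_deg; rewrite ltnS degD leq_addr.
rewrite (qmul_box _ _ lt_acN) -(pair_big_dep xpredT
  (fun x y : box N => unbox x + unbox y == a + c) (fun x y : box N =>
  qh ^ lambda B (unbox x) (unbox y) * (Ymon a (unbox x) * f (unbox y)))) /=.
rewrite (bigD1 a') //= [X in _ + X]big1 ?addr0 => [|x xa]; last first.
  apply: big1 => y _; rewrite /Ymon -a'E (inj_eq (@unbox_inj _)) (negPf xa).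
  by rewrite mul0r mulr0.
rewrite a'E /Ymon eqxx -(big_box (fun x => qh ^ lambda B a x * f x)
  (_ : (deg c < N)%N)); last by rewrite ltnS [X in (_ <= X)%N]degD leq_addl.
by apply: eq_big => [b|b _]; rewrite ?mul1r // (inj_eq (@expD_inj a)).
Qed.

Lemma qmul_Ymonr f a c : qmul f (Ymon a) (c + a) = qh ^ lambda B c a * f c.
Proof.
pose N := (deg (c + a)).+1; have lt_caN : (deg (c + a) < N)%N by [].
have [r|a' a'E] := @unbox_onto N a.
  by apply: lt_deg; rewrite ltnS degD leq_addl.
rewrite (qmul_box _ _ lt_caN) -(pair_big_dep xpredT
  (fun x y : box N => unbox x + unbox y == c + a) (fun x y : box N =>
  qh ^ lambda B (unbox x) (unbox y) * (f (unbox x) * Ymon a (unbox y)))) /=.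
rewrite (exchange_big_dep xpredT) //=.
rewrite (bigD1 a') //= [X in _ + X]big1 ?addr0 => [|x xa]; last first.
  apply: big1 => y _; rewrite /Ymon -a'E (inj_eq (@unbox_inj _)) (negPf xa).
  by rewrite !mulr0.
rewrite a'E /Ymon eqxx -(big_box (fun x => qh ^ lambda B x a * f x)
  (_ : (deg c < N)%N)); last by rewrite ltnS [X in (_ <= X)%N]degD leq_addr.
by apply: eq_big => [b|b _]; rewrite ?mulr1 // ![_ + a]addrC (inj_eq (@expD_inj a)).
Qed.

Lemma qmul_Ymon a b :
  qmul (Ymon a) (Ymon b) = fun c => qh ^ lambda B a b * Ymon (a + b) c.
Proof.
apply/funext => c; rewrite [in RHS]/Ymon; case: eqP => [->|/eqP cab].
  by rewrite qmul_Ymonl /Ymon eqxx.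
rewrite mulr0 /qmul big1 // => p /eqP pc; rewrite /Ymon.
case: eqP => [pa|]; last by rewrite mul0r mulr0.
case: eqP => [pb|]; last by rewrite !mulr0.
by rewrite -pc pa pb eqxx in cab.
Qed.

Lemma qmul1l : left_id (Ymon 0) qmul.
Proof.
move=> f; apply/funext => c.
by rewrite -{1}(add0r c) qmul_Ymonl lambda0l expr0z mul1r.
Qed.

Lemma qmul1r : right_id (Ymon 0) qmul.
Proof.
move=> f; apply/funext => c.
by rewrite -{1}(addr0 c) qmul_Ymonr lambda0r expr0z mul1r.
Qed.

Lemma qmulDl : left_distributive qmul +%R.
Proof.
move=> f g h; apply/funext => c; rewrite [RHS]/+%R /= /qmul -big_split /=.
by apply: eq_bigr => p _; rewrite -mulrDr -mulrDl.
Qed.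

Lemma qmulDr : right_distributive qmul +%R.
Proof.
move=> f g h; apply/funext => c; rewrite [RHS]/+%R /= /qmul -big_split /=.
by apply: eq_bigr => p _; rewrite -!mulrDr.
Qed.

Lemma Ymon0_neq0 : Ymon 0 != 0 :> qaff B.
Proof.
apply/eqP => /(congr1 (@^~ 0)); rewrite /Ymon eqxx => /eqP.
by rewrite oner_eq0.
Qed.

End QuantumAffine.

Arguments Ymon {R B} a.

HB.instance Definition _ (R : finType) (B : R -> R -> int) :=
  GRing.Zmodule_isNzRing.Build (qaff B) (@qmulA R B) (@qmul1l R B)
    (@qmul1r R B) (@qmulDl R B) (@qmulDr R B) (@Ymon0_neq0 R B).

Section PowerSeries.
Variables (R : finType) (B : R -> R -> int).
Implicit Types (a b c : {ffun R -> nat}) (f g h : qaff B).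

(* The substitution of f into the power series sum_n e_n x^n, for f without
   constant term: the coefficient of f^n at c vanishes for n > deg c. *)
Definition psubst (e : nat -> KK) f : qaff B := fun c =>
  \sum_(n < (deg c).+1) e n * coef c (f ^+ n).

Definition qscal (x : KK) : qaff B := fun c => x * (Ymon 0 : qaff B) c.

Definition qunit : pred (qaff B) := fun f => coef 0 f != 0.

(* The geometric series 1 / (x (1 - u)) = (sum_n u^n) / x. *)
Definition qinv f : qaff B :=
  if f \in qunit then
    psubst (fun=> 1) (1 - qscal (coef 0 f)^-1 * f) * qscal (coef 0 f)^-1
  else f.

Lemma coefB c f g : coef c (f - g) = coef c f - coef c g.
Proof. by []. Qed.

Lemma coef_sum c (I : Type) (r : seq I) (F : I -> qaff B) :
  coef c (\sum_(i <- r) F i) = \sum_(i <- r) coef c (F i).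
Proof. by elim/big_rec2: _ => // i x f _ <-. Qed.

Lemma coefM c f g : coef c (f * g) =
  \sum_(p : box R (deg c).+1 * box R (deg c).+1 | unbox p.1 + unbox p.2 == c)
    qh ^ lambda B (unbox p.1) (unbox p.2)
      * (coef (unbox p.1) f * coef (unbox p.2) g).
Proof. by []. Qed.

Lemma eq_coefM c f f' g g' :
  (forall a, (deg a <= deg c)%N -> coef a f = coef a f') ->
  (forall a, (deg a <= deg c)%N -> coef a g = coef a g') ->
  coef c (f * g) = coef c (f' * g').
Proof.
move=> ff gg; rewrite !coefM; apply: eq_bigr => p /eqP pc.
by rewrite ff ?gg ?(leq_degl pc) ?(leq_degr pc).
Qed.

Lemma coef0M f g : coef 0 (f * g) = coef 0 f * coef 0 g.
Proof.
have -> : coef 0 (f * g) = coef 0 (qscal (coef 0 f) * g).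
  apply: eq_coefM => // a; rewrite deg0 leqn0 deg_eq0 => /eqP ->.
  by rewrite /coef /qscal /Ymon eqxx mulr1.
have -> : coef 0 (qscal (coef 0 f) * g)
        = coef 0 f * coef 0 ((1 : qaff B) * g).
  rewrite !coefM mulr_sumr; apply: eq_bigr => p _.
  have -> : coef (unbox p.1) (qscal (coef 0 f))
          = coef 0 f * coef (unbox p.1) (1 : qaff B) by [].
  by rewrite -!mulrA mulrCA.
by rewrite mul1r.
Qed.

Lemma coef_exp0 f n c : coef 0 f = 0 -> (deg c < n)%N -> coef c (f ^+ n) = 0.
Proof.
move=> f0; elim: n c => // n IHn c; rewrite ltnS => cn.
rewrite exprS coefM big1 // => p /eqP pc.
have [p0|pn0] := eqVneq (unbox p.1) 0; first by rewrite p0 f0 mul0r mulr0.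
by rewrite (IHn (unbox p.2)) ?mulr0 //; apply: leq_trans cn; apply: ltn_degr pc.
Qed.

Lemma psubstE e f c N : coef 0 f = 0 -> (deg c < N)%N ->
  coef c (psubst e f) = \sum_(n < N) e n * coef c (f ^+ n).
Proof.
move=> f0 cN.
rewrite -[LHS]/(\sum_(n < (deg c).+1) e n * coef c (f ^+ n)).
rewrite (big_ord_widen N (fun n => e n * coef c (f ^+ n))) //.
rewrite [RHS](bigID (fun n : 'I_N => (n < (deg c).+1)%N)) /= [X in _ + X]big1.
  by rewrite addr0.
by move=> n; rewrite -leqNgt => cn; rewrite coef_exp0 ?mulr0.
Qed.

Lemma geom_eq f c : coef 0 f = 0 -> forall a, (deg a <= deg c)%N ->
  coef a (psubst (fun=> 1) f) = coef a (\sum_(n < (deg c).+1) f ^+ n).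
Proof.
move=> f0 a ac; rewrite (@psubstE _ _ _ (deg c).+1) // coef_sum.
by apply: eq_bigr => n _; rewrite mul1r.
Qed.

Lemma geom_sum f c : coef 0 f = 0 ->
  coef c ((1 - f) * \sum_(n < (deg c).+1) f ^+ n) = coef c (1 : qaff B).
Proof.
move=> f0; rewrite -opprB mulNr -subrX1 opprB coefB.
by rewrite (coef_exp0 f0) ?subr0.
Qed.

Lemma geomMl f : coef 0 f = 0 -> (1 - f) * psubst (fun=> 1) f = 1.
Proof.
move=> f0; apply/funext => c; rewrite -[LHS]/(coef c _) -[RHS]/(coef c (1 : qaff B)).
by rewrite (eq_coefM (fun _ _ => erefl) (geom_eq f0)) geom_sum.
Qed.

Lemma geomMr f : coef 0 f = 0 -> psubst (fun=> 1) f * (1 - f) = 1.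
Proof.
move=> f0; apply/funext => c; rewrite -[LHS]/(coef c _) -[RHS]/(coef c (1 : qaff B)).
rewrite (eq_coefM (geom_eq f0) (fun _ _ => erefl)) -(geom_sum c f0).
congr (coef c _); apply/esym/commr_sum => n _; apply/commrX/commr_sym/commrB.
  exact: commr1.
exact: commr_refl.
Qed.

Lemma qscalM x y : qscal x * qscal y = qscal (x * y).
Proof.
apply/funext => c; rewrite -[LHS]/(coef c _) coefM /qscal.
transitivity (x * y * coef c ((Ymon 0 : qaff B) * Ymon 0)).
  by rewrite coefM mulr_sumr; apply: eq_bigr => p _; rewrite /coef; ring.
by rewrite [Ymon 0 * _]mul1r.
Qed.

Lemma qscal1 : qscal 1 = 1.
Proof. by apply/funext => c; rewrite /qscal mul1r. Qed.

Lemma coef0_qscal x : coef 0 (qscal x) = x.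
Proof. by rewrite /coef /qscal /Ymon eqxx mulr1. Qed.

Lemma coef0_unit f : f \in qunit ->
  coef 0 (1 - qscal (coef 0 f)^-1 * f) = 0.
Proof.
move=> fu; rewrite coefB coef0M coef0_qscal mulVf //.
by rewrite -[X in coef 0 X - _]qscal1 coef0_qscal subrr.
Qed.

Lemma qmulVr : {in qunit, left_inverse 1 qinv *%R}.
Proof.
move=> f fu; rewrite /qinv fu -mulrA.
by have := geomMr (coef0_unit fu); rewrite subKr.
Qed.

Lemma qmulrV : {in qunit, right_inverse 1 qinv *%R}.
Proof.
move=> f fu; rewrite /qinv fu mulrA.
have := geomMl (coef0_unit fu); rewrite subKr.
move: (psubst _ _) => G; move: (coef 0 f) (fu : coef 0 f != 0) => x x0 fG.
suff -> : f * G = qscal x by rewrite qscalM mulfV // qscal1.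
by rewrite -[LHS]mul1r -qscal1 -(mulfV x0) -qscalM -mulrA [X in _ * X]mulrA fG mulr1.
Qed.

Lemma qunitP f g : g * f = 1 /\ f * g = 1 -> f \in qunit.
Proof.
case=> gf _; apply/negP => /eqP f0; have /eqP := congr1 (coef 0) gf.
rewrite coef0M f0 mulr0 -[1]qscal1 coef0_qscal eq_sym.
by rewrite oner_eq0.
Qed.

Lemma qinv_out : {in [predC qunit], qinv =1 id}.
Proof. by move=> f /negPf fu; rewrite /qinv fu. Qed.

End PowerSeries.

HB.instance Definition _ (R : finType) (B : R -> R -> int) :=
  GRing.NzRing_hasMulInverse.Build (qaff B) (@qmulVr R B) (@qmulrV R B)
    (@qunitP R B) (@qinv_out R B).

Definition dilog_coef (n : nat) : KK :=
  qh ^+ (n ^ 2) / \prod_(k < n) (q ^+ n - q ^+ k).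

Definition dilog (R : finType) (B : R -> R -> int) (f : qaff B) : qaff B :=
  psubst dilog_coef f.

Section EEdef.
Variables (R : finType) (B : R -> R -> int).

(* For a sign-coherent b <> 0,
   tropsign b is the sign eps such that eps b is in N^R, and tropabs b = eps b. *)
Definition tropsign (b : Trop R) : int :=
  if [forall r, 0 <= (b : {ffun R -> int}) r] then 1 else -1.

Definition tropabs (b : Trop R) : {ffun R -> nat} :=
  [ffun r => `|(b : {ffun R -> int}) r|%N].

Definition dilog_factor (b : Trop R) : qaff B :=
  dilog (Ymon (tropabs b)) ^ tropsign b.

Fixpoint EE (s : Yseed R (Trop R)) (ops : seq (op R)) : qaff B :=
  if ops is o :: ops' then
    (if o is Mut k then dilog_factor (sy s k) else 1) * EE (apply_op s o) ops'
  else 1.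

End EEdef.

Definition EEmu (m : nat) (P : Y0 m) (u : int) : qaff (@BB m P) :=
  EE (@BB m P) (init P) (mupow P u).

Arguments EEmu {m} P u.

(* Matrices over 'I_2, with indices 0, 1 standing for 1, 2. *)
Definition mx22 (T : Type) (a b c d : T) : 'M[T]_2 :=
  \matrix_(i, j) if i == 0 then (if j == 0 then a else b)
                 else (if j == 0 then c else d).

Definition six_pairs : seq ('M[{poly int}]_2 * 'M[{poly int}]_2) :=
  [:: (mx22 (1 + 'X^2) (- 'X) (- 'X) (1 + 'X^2),
       mx22 (1 + 'X^2) 0 0 (1 + 'X^2));
      (mx22 (1 + 'X^2) (- 'X) (- 'X - 'X^5) (1 + 'X^6),
       mx22 (1 + 'X^2) 0 (- 'X^3) (1 + 'X^6));
      (mx22 (1 + 'X^2) (- 'X) (- 'X - 'X^5 - 'X^9) (1 + 'X^10),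
       mx22 (1 + 'X^2) 0 (- 'X^3 - 'X^7) (1 + 'X^10));
      (mx22 (1 + 'X^2) (- 'X) (- 'X) (1 + 'X^2),
       mx22 (1 + 'X^2 - 'X) 0 0 (1 + 'X^2 - 'X));
      (mx22 (1 + 'X^2) (- 'X) (- 'X - 'X^2) (1 + 'X^3),
       mx22 (1 + 'X^2 - 'X) 0 0 (1 + 'X^3));
      (mx22 (1 + 'X^2) (- 'X) (- 'X) (1 + 'X^2 - 'X),
       mx22 (1 + 'X^2) 0 0 (1 + 'X^2))].

(* Main.v *)
Require Import Defs.
From mathcomp Require Import all_boot all_order all_fingroup all_algebra.
From mathcomp Require Import boolp ring zify.

Set Implicit Arguments.
Unset Strict Implicit.
Unset Printing Implicit Defensive.

Import Order.TTheory GRing.Theory Num.Theory.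
Local Open Scope ring_scope.

(** Write E(a) for the quantum dilogarithm of Y^a.  Both sides of the identity
are products of factors E(a) and E(a)^-1, one for each mutation, and the idea
is to turn one product into the other with the two local relations that such
factors satisfy:
- if lambda(a, b) = 0, then E(a) and E(b) commute ([dilog_mono_comm]);
- if lambda(a, b) = 1, then E(a) E(b) = E(b) E(a + b) E(a), the pentagon
  identity ([pentagon]).

The pentagon identity is a statement about coefficients.  Both sides are sums
of multiples of the monomials Y^(m a + n b), and comparing them for fixed m and
n leaves an identity between the coefficients of E ([dilog_coef_pentagon]).
Up to a common factor it is the expansion of x^m at x = q^n in the basis of the
products (x - 1)(x - q)...(x - q^(j-1)), whose coefficients are the Gaussian
binomial coefficients ([expr_qbinom]).

That the two products are related by such moves reflects the fact that both
mutation sequences end with y-variables whose exponents are all nonpositive, so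
that both products compute the Donaldson-Thomas invariant of the quiver of B.  For the six pairs the quiver is
small and the moves can be given explicitly.  A product is encoded as a word
whose letters are signed exponent vectors.  At a given position of a word at
most one move applies, and the form lambda on the adjacent letters decides
which ([flip_head]); a path of moves is therefore just a list of positions.  As
every move preserves the value of the word ([flips_val]), an identity between
products follows from two lists of positions that lead the two words to a
common one ([same_by_val]).

It remains to obtain the words themselves and the numbers h_+ and h_-.  The
mutation sequences are carried out on tables of integers, which represent seeds
once the vertices are numbered ([represents_run], [represents_word]).  The
integers n_{ij;p} are the coefficients of A_- - A_+ and the r_i are the degrees
of the diagonal entries of A_+ ([nn_coef], [size_Aplus]), so each of the six
pairs reduces to one computation on tables ([EEmu_eq]). *)

(** * Gaussian binomial coefficients and the coefficients of E *)

Section GaussianBinomials.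
Variables (F : comNzRingType) (v : F).

Fixpoint qbinom (m j : nat) : F :=
  match m, j with
  | _, 0 => 1
  | 0, _.+1 => 0
  | m'.+1, j'.+1 => qbinom m' j' + v ^+ j * qbinom m' j
  end.

(** The q-factorial without the factors 1 / (v - 1): this is the normalization
    in the denominators of the quantum dilogarithm. *)
Definition qfact (n : nat) : F := \prod_(k < n) (v ^+ k.+1 - 1).

Definition qfall (x : F) (j : nat) : F := \prod_(k < j) (x - v ^+ k).

Lemma qbinomn0 m : qbinom m 0 = 1. Proof. by case: m. Qed.

Lemma qbinom_small m j : (m < j)%N -> qbinom m j = 0.
Proof.
elim: m j => [|m IHm] [|j] //=; rewrite ltnS => mj.
by rewrite !IHm ?mulr0 ?addr0 // ltnW.
Qed.

Lemma qfactS n : qfact n.+1 = qfact n * (v ^+ n.+1 - 1).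
Proof. by rewrite /qfact big_ord_recr. Qed.

Lemma qfallS x j : qfall x j.+1 = qfall x j * (x - v ^+ j).
Proof. by rewrite /qfall big_ord_recr. Qed.

(** Induction on m: multiplying the j-th product by x gives the (j+1)-st one
    plus v^j times the j-th, which is the recursion that defines [qbinom]. *)
Lemma expr_qbinom x m : x ^+ m = \sum_(j < m.+1) qbinom m j * qfall x j.
Proof.
elim: m => [|m IHm].
  by rewrite big_ord_recl big_ord0 /= /qfall big_ord0 expr0 mulr1 addr0.
rewrite exprSr IHm mulr_suml.
transitivity (\sum_(j < m.+1)
    (qbinom m j * qfall x j.+1 + v ^+ j * qbinom m j * qfall x j)).
  by apply: eq_bigr => j _; rewrite qfallS; ring.
rewrite big_split /= [X in _ + X]big_ord_recl [in RHS]big_ord_recl /=.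
rewrite !qbinomn0 expr0 mul1r addrCA; congr (_ + _).
under [RHS]eq_bigr => j _ do rewrite mulrDl.
rewrite [RHS]big_split /=; congr (_ + _).
by rewrite [RHS]big_ord_recr /= qbinom_small // mulr0 mul0r addr0.
Qed.

Lemma qbinom_fact m j : (j <= m)%N ->
  qbinom m j * (qfact j * qfact (m - j)) = qfact m.
Proof.
elim: m j => [|m IHm] [|j] //=.
- by rewrite /qfact !big_ord0 !mul1r.
- by rewrite subn0 /qfact big_ord0 !mul1r.
rewrite ltnS subSS => jm; rewrite mulrDl.
have -> : qbinom m j * (qfact j.+1 * qfact (m - j))
    = (v ^+ j.+1 - 1) * qfact m.
  by rewrite -(IHm j jm) qfactS; ring.
move: jm; rewrite leq_eqVlt => /predU1P[->|jm].
  by rewrite qbinom_small // mulr0 mul0r addr0 qfactS mulrC.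
rewrite -[(m - j)%N]prednK ?subn_gt0 // -subnS (qfactS (m - j.+1)).
have -> : v ^+ j.+1 * qbinom m j.+1
      * (qfact j.+1 * (qfact (m - j.+1) * (v ^+ (m - j.+1).+1 - 1)))
    = (v ^+ j.+1 * v ^+ (m - j.+1).+1 - v ^+ j.+1) * qfact m.
  by rewrite -(IHm j.+1 jm); ring.
by rewrite -exprD addnS subnKC // qfactS; ring.
Qed.

(** Each factor v^n - v^k equals v^k (v^(n-k) - 1); the powers v^k multiply to
    v^C(j, 2). *)
Lemma qfall_exp n j : (j <= n)%N ->
  qfall (v ^+ n) j * qfact (n - j) = v ^+ 'C(j, 2) * qfact n.
Proof.
elim: j => [|j IHj] jn.
  by rewrite subn0 /qfall big_ord0 expr0.
have <- : v ^+ j * (qfall (v ^+ n) j * qfact (n - j)) = v ^+ 'C(j.+1, 2) * qfact n.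
  by rewrite IHj 1?ltnW // binS bin1 exprD; ring.
have -> : (n - j = (n - j.+1).+1)%N by lia.
rewrite qfallS qfactS.
have -> : v ^+ n = v ^+ j * v ^+ (n - j.+1).+1.
  by rewrite -exprD addnS -addSn subnKC.
ring.
Qed.

Lemma qfall_small n j : (n < j)%N -> qfall (v ^+ n) j = 0.
Proof.
by move=> nj; rewrite /qfall (bigD1 (Ordinal nj)) //= subrr mul0r.
Qed.

End GaussianBinomials.

Section DilogCoefficients.
Variables (F : fieldType) (t : F).
Hypotheses (t_neq0 : t != 0) (t_exp : forall n, (0 < n)%N -> t ^+ n != 1).

Let v := t ^+ 2.

Lemma sqrn_bin n : (n ^ 2 = n + 2 * 'C(n, 2))%N.
Proof. by elim: n => // n IHn; rewrite binS bin1; lia. Qed.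

Lemma qfact_neq0 n : qfact v n != 0.
Proof.
rewrite /qfact prodf_seq_neq0; apply/allP => k _.
by rewrite subr_eq0 /v -exprM t_exp.
Qed.

(** The coefficients of E, with an arbitrary t that is not a root of unity in
    place of the square root of q. *)
Definition dcoef n := t ^+ (n ^ 2) / \prod_(k < n) (v ^+ n - v ^+ k).

Lemma dcoefE n : dcoef n = t ^+ n / qfact v n.
Proof.
rewrite /dcoef -[\prod_(k < n) _]/(qfall v (v ^+ n) n).
have := qfall_exp v (leqnn n); rewrite subnn {1}/qfact big_ord0 mulr1 => ->.
rewrite sqrn_bin exprD exprM -/v invfM mulrA mulfK //.
by rewrite !expf_neq0.
Qed.

(** Multiplied by the q-factorials of m and n, this is the expansion
    [expr_qbinom] of x^m at x = v^n: the j-th summand is the Gaussian binomial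
    coefficient of m over j times (x - 1)(x - v)...(x - v^(j-1)). *)
Lemma dcoef_pentagon m n N : (m < N)%N ->
  \sum_(j < N | (j <= n)%N && (j <= m)%N)
    dcoef (n - j) * dcoef j * dcoef (m - j) * t ^+ (j ^ 2)
  = dcoef m * dcoef n * t ^+ (2 * m * n).
Proof.
move=> mN.
have main : v ^+ (m * n)%N = \sum_(j < N | (j <= n)%N && (j <= m)%N)
    v ^+ 'C(j, 2) * qfact v n * qfact v m
      / (qfact v (n - j) * qfact v j * qfact v (m - j)).
  (* The terms j > n of the expansion vanish: x = v^n is a root of the product. *)
  rewrite mulnC exprM (expr_qbinom v).
  rewrite (big_ord_widen N (fun j => qbinom v m j * qfall v (v ^+ n) j)) //.
  rewrite (bigID (fun j : 'I_N => (j <= n)%N)) /= [X in _ + X]big1 ?addr0.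
    apply: eq_big => [j|j /andP[jm jn]]; first by rewrite andbC ltnS.
    have -> : qfall v (v ^+ n) j = v ^+ 'C(j, 2) * qfact v n / qfact v (n - j).
      by apply: (canRL (mulfK _)); rewrite ?qfact_neq0 // qfall_exp.
    rewrite -(qbinom_fact v (jm : (j <= m)%N)).
    by field; rewrite !qfact_neq0.
  by move=> j /andP[_]; rewrite -ltnNge => nj; rewrite qfall_small ?mulr0.
have -> : dcoef m * dcoef n * t ^+ (2 * m * n)
    = v ^+ (m * n) * (t ^+ (m + n) / (qfact v m * qfact v n)).
  rewrite !dcoefE -mulnA [t ^+ (2 * _)]exprM -/v exprD.
  by field; rewrite !qfact_neq0.
rewrite main mulr_suml; apply: eq_bigr => j /andP[jn jm].
rewrite sqrn_bin exprD exprM -/v !dcoefE.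
have -> : (m + n = (n - j) + (m - j) + (j + j))%N by lia.
rewrite !exprD.
by field; rewrite !qfact_neq0.
Qed.

End DilogCoefficients.

Lemma qh_exp_neq1 n : (0 < n)%N -> qh ^+ n != 1.
Proof.
move=> n0; rewrite /qh -tofracXn -tofrac1 tofrac_eq; apply/eqP.
by move/(congr1 (fun p : {poly rat} => size p)); rewrite size_polyXn size_poly1; lia.
Qed.

Lemma dilog_coef_pentagon m n N : (m < N)%N ->
  \sum_(j < N | (j <= n)%N && (j <= m)%N)
    dilog_coef (n - j) * dilog_coef j * dilog_coef (m - j) * qh ^+ (j ^ 2)
  = dilog_coef m * dilog_coef n * qh ^+ (2 * m * n).
Proof. exact: (dcoef_pentagon qh_neq0 qh_exp_neq1). Qed.

(** * The pentagon identity *)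

Section QuantumDilogarithm.
Variables (R : finType) (B : R -> R -> int).
Hypothesis Bskew : forall r s, B r s = - B s r.
Implicit Types (a b c : {ffun R -> nat}) (f g : qaff B) (x y : KK).

Lemma lambda_skew a b : lambda B a b = - lambda B b a.
Proof.
rewrite /lambda exchange_big -sumrN /=; apply: eq_bigr => s _.
rewrite -sumrN; apply: eq_bigr => r _; rewrite [B r s]Bskew; ring.
Qed.

Lemma lambda_diag a : lambda B a a = 0.
Proof. by have := lambda_skew a a; lia. Qed.

Lemma lambdaMnl a b n : lambda B (a *+ n) b = lambda B a b *+ n.
Proof. by elim: n => [|n IHn]; rewrite ?lambda0l // !mulrS lambdaDl IHn. Qed.

Lemma lambdaMnr a b n : lambda B a (b *+ n) = lambda B a b *+ n.
Proof. by rewrite lambda_skew lambdaMnl lambda_skew -mulNrn opprK. Qed.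

Definition mono x a : qaff B := qscal B x * Ymon a.

Lemma coef_qscal x f c : coef c (qscal B x * f) = x * coef c f.
Proof.
rewrite -[f in RHS]mul1r !Defs.coefM mulr_sumr; apply: eq_bigr => p _.
have -> : coef (unbox p.1) (qscal B x) = x * coef (unbox p.1) (1 : qaff B) by [].
by ring.
Qed.

Lemma coef_mono x a c : coef c (mono x a) = x * (c == a)%:R.
Proof. exact: coef_qscal. Qed.

Lemma mono_mul x y a b :
  mono x a * mono y b = mono (x * y * qh ^ lambda B a b) (a + b).
Proof.
have qscal_comm f : f * qscal B y = qscal B y * f.
  apply/funext => c; rewrite -[LHS]/(coef c _) -[RHS]/(coef c _) coef_qscal.
  rewrite -[f in RHS]mulr1 !Defs.coefM mulr_sumr; apply: eq_bigr => p _.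
  have -> : coef (unbox p.2) (qscal B y) = y * coef (unbox p.2) (1 : qaff B).
    by [].
  by ring.
apply/funext => c; rewrite -[LHS]/(coef c _) -[RHS]/(coef c _) coef_mono.
rewrite /mono mulrA -[_ * Ymon a * _]mulrA qscal_comm mulrA qscalM -mulrA.
have -> : (Ymon a : qaff B) * Ymon b = (fun c => qh ^ lambda B a b * (Ymon (a + b) : qaff B) c).
  exact: qmul_Ymon.
by rewrite coef_qscal /coef /Ymon; ring.
Qed.

Lemma monoE a : Ymon a = mono 1 a.
Proof. by rewrite /mono qscal1 mul1r. Qed.

Lemma Ymon_exp a n : Ymon a ^+ n = Ymon (a *+ n) :> qaff B.
Proof.
elim: n => // n IHn; rewrite exprSr IHn !monoE mono_mul lambdaMnl lambda_diag.
by rewrite mul0rn expr0z !mul1r mulrSr.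
Qed.

Definition dilog_mono a : qaff B := dilog (Ymon a).

(** E(Y^a) agrees with this finite sum in degrees below N; finite sums are what
    the ring operations distribute over. *)
Definition dilog_trunc N a : qaff B := \sum_(n < N) mono (dilog_coef n) (a *+ n).

Lemma coef_dilog_mono N a c : a != 0 -> (deg c < N)%N ->
  coef c (dilog_mono a) = coef c (dilog_trunc N a).
Proof.
move=> a0 cN; rewrite (psubstE _ _ cN); last by rewrite /coef /Ymon eq_sym (negPf a0).
rewrite Defs.coef_sum; apply: eq_bigr => n _.
by rewrite coef_mono Ymon_exp.
Qed.

Lemma coef_dilog_mono0 a : coef 0 (dilog_mono a) = 1.
Proof.
rewrite /coef /dilog_mono /dilog /psubst deg0 big_ord1 expr0 /dilog_coef.
by rewrite big_ord0 divr1 expr0 mul1r -[1]qscal1 -/(coef _ _) coef0_qscal.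
Qed.

Lemma dilog_mono_unit a : dilog_mono a \is a GRing.unit.
Proof. by rewrite -[_ \is a _]/(coef 0 _ != 0) coef_dilog_mono0 oner_eq0. Qed.

Lemma dilog_mono0 : dilog_mono 0 = 1.
Proof.
apply/funext => c; rewrite -[LHS]/(coef c _) -[RHS]/(coef c (1 : qaff B)).
have [->|c0] := eqVneq c 0.
  by rewrite coef_dilog_mono0 -qscal1 coef0_qscal.
have c1 : coef c (1 : qaff B) = 0 by rewrite /coef -[1]/(Ymon 0) /Ymon (negPf c0).
rewrite c1; apply: big1 => n _.
by rewrite -[Ymon 0]/(1 : qaff B) expr1n c1 mulr0.
Qed.

Lemma dilog_mono_comm a b : lambda B a b = 0 ->
  dilog_mono a * dilog_mono b = dilog_mono b * dilog_mono a.
Proof.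
move=> ab0; have [->|a0] := eqVneq a 0; first by rewrite dilog_mono0 mul1r mulr1.
have [->|b0] := eqVneq b 0; first by rewrite dilog_mono0 mul1r mulr1.
apply/funext => c; rewrite -[LHS]/(coef c _) -[RHS]/(coef c _).
pose N := (deg c).+1.
have trunc d s : d != 0 -> (deg s <= deg c)%N ->
    coef s (dilog_mono d) = coef s (dilog_trunc N d).
  by move=> d0 sc; apply: coef_dilog_mono.
rewrite (eq_coefM (fun s => @trunc a s a0) (fun s => @trunc b s b0)).
rewrite (eq_coefM (fun s => @trunc b s b0) (fun s => @trunc a s a0)).
suff ab_comm : GRing.comm (dilog_trunc N a) (dilog_trunc N b) by rewrite ab_comm.
rewrite /dilog_trunc; apply: commr_sum => n _; apply: commr_sym.
apply: commr_sum => m _; apply: commr_sym.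
rewrite /GRing.comm !mono_mul addrC [_ * dilog_coef m]mulrC !lambdaMnl !lambdaMnr.
by rewrite [lambda B b a]lambda_skew ab0 oppr0 !mul0rn.
Qed.

(** Substituting n = i + j: the terms with i + j >= N that the left side has in
    excess are zero. *)
Lemma sum_shift (g : nat -> KK) N j : (forall n, (N <= n)%N -> g n = 0) ->
  \sum_(i < N) g (i + j)%N = \sum_(n < N | (j <= n)%N) g n.
Proof.
move=> gN.
transitivity (\sum_(j <= n < N + j) g n).
  by rewrite -[X in \sum_(X <= _ < _) _]add0n big_addn addnK big_mkord.
rewrite -(big_mkord (fun n => j <= n)%N).
rewrite -[RHS](big_nat_widenl j 0 N xpredT) //.
have [jN|Nj] := leqP j N.
  rewrite [LHS](@big_cat_nat _ _ _ N) //= ?leq_addr // [X in _ + X]big_nat_cond.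
  by rewrite [X in _ + X]big1 ?addr0 // => n /andP[/andP[/gN]].
rewrite [RHS]big_geq 1?ltnW // big_nat_cond big1 // => n /andP[/andP[jn _] _].
by apply: gN; apply: leq_trans jn; apply: ltnW.
Qed.

(** In degree c both sides are finite sums over monomials Y^(m a + n b).  On the
    left (m, n) are the two summation indices.  On the right the indices i, j, k
    of the three factors give m = k + j and n = i + j, so grouping the
    terms by (m, n) leaves the identity [dilog_coef_pentagon] for every (m, n). *)
Lemma pentagon a b : lambda B a b = 1 ->
  dilog_mono a * dilog_mono b
  = dilog_mono b * dilog_mono (a + b) * dilog_mono a.
Proof.
move=> ab1; have ba1 : lambda B b a = -1 by rewrite lambda_skew ab1.
have a0 : a != 0 by apply: contra_eq_neq ab1 => ->; rewrite lambda0l.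
have b0 : b != 0 by apply: contra_eq_neq ab1 => ->; rewrite lambda0r.
have ab0 : a + b != 0.
  by apply: contra_eq_neq ab1 => ab; rewrite -[lambda B a b]add0r -(lambda_diag a) -lambdaDr ab lambda0r.
apply/funext => c; rewrite -[LHS]/(coef c _) -[RHS]/(coef c _).
pose N := (deg c).+1.
have trunc d s : d != 0 -> (deg s <= deg c)%N ->
    coef s (dilog_mono d) = coef s (dilog_trunc N d).
  by move=> d0 sc; apply: coef_dilog_mono.
rewrite (eq_coefM (fun s => @trunc a s a0) (fun s => @trunc b s b0)).
have -> : coef c (dilog_mono b * dilog_mono (a + b) * dilog_mono a)
    = coef c (dilog_trunc N b * dilog_trunc N (a + b) * dilog_trunc N a).
  apply: eq_coefM => s sc; last exact: trunc.
  by apply: eq_coefM => u us; apply: trunc => //; apply: leq_trans sc.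
(* H m n tests whether (m, n) contributes to Y^c; it vanishes outside the square
   m, n < N because a and b have positive degree. *)
pose H (m n : nat) : KK := (c == a *+ m + b *+ n)%:R.
have degMn (d : {ffun R -> nat}) n : d != 0 -> (n <= deg (d *+ n))%N.
  move=> d0; have dd0 : (0 < deg d)%N by rewrite lt0n deg_eq0.
  elim: n => // n IHn; rewrite mulrS degD -add1n.
  exact: leq_add.
have Hm m n : (N <= m)%N -> H m n = 0.
  move=> Nm; rewrite /H; case: eqP => // cE.
  by move: Nm; rewrite /N cE degD; have := degMn a m a0; lia.
have Hn m n : (N <= n)%N -> H m n = 0.
  move=> Nn; rewrite /H; case: eqP => // cE.
  by move: Nn; rewrite /N cE degD; have := degMn b n b0; lia.
pose e := dilog_coef.
transitivity (\sum_(n < N) \sum_(m < N) e m * e n * qh ^+ (m * n) * H m n).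
  rewrite exchange_big /= mulr_suml Defs.coef_sum; apply: eq_bigr => m _.
  rewrite mulr_sumr Defs.coef_sum; apply: eq_bigr => n _.
  rewrite mono_mul coef_mono lambdaMnl lambdaMnr ab1.
  by rewrite -mulrnA natz mulnC.
(* The coefficient of the product of the i-th, j-th and k-th terms. *)
pose Z i j k := e i * e j * e k
  * qh ^ lambda B (b *+ i) ((a + b) *+ j) * qh ^ lambda B (b *+ i + (a + b) *+ j) (a *+ k).
transitivity (\sum_(j < N) \sum_(i < N) \sum_(k < N) Z i j k * H (k + j)%N (i + j)%N).
  pose G j n := \sum_(m < N | (j <= m)%N) Z (n - j)%N j (m - j)%N * H m n.
  have inner (j : nat) : \sum_(i < N) \sum_(k < N) Z i j k * H (k + j)%N (i + j)%N
      = \sum_(n < N | (j <= n)%N) G j n.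
    rewrite -(sum_shift (g := G j)) => [|n Nn]; last first.
      by rewrite /G big1 // => m _; rewrite Hn ?mulr0.
    apply: eq_bigr => i _; rewrite /G addnK.
    rewrite -(sum_shift (g := fun m => Z i j (m - j)%N * H m (i + j)%N)).
      by apply: eq_bigr => k _; rewrite addnK.
    by move=> m Nm; rewrite Hm ?mulr0.
  under [RHS]eq_bigr => j _ do rewrite inner.
  rewrite [RHS](exchange_big_dep xpredT) //=; apply: eq_bigr => n _.
  rewrite [RHS](exchange_big_dep xpredT) //=; apply: eq_bigr => m _.
  rewrite -mulr_suml; congr (_ * _).
  (* The exponent of the square root of q in Z (n - j) j (m - j) is
     j ^ 2 - m n: multiplying by its m n-th power makes all exponents
     nonnegative. *)
  apply: (mulIf (expf_neq0 (m * n) qh_neq0)); rewrite mulr_suml.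
  transitivity (e m * e n * qh ^+ (2 * m * n)).
    by rewrite -[LHS]mulrA -exprD; congr (_ * _ ^+ _); lia.
  rewrite -(@dilog_coef_pentagon m n N) ?ltn_ord //.
  apply: eq_big => [j|j /andP[jn jm]]; first by [].
  rewrite /Z -[RHS]mulrA -[RHS]mulrA !exprnP -!expfzDr ?qh_neq0 //; congr (_ * _ ^ _).
  rewrite lambdaDl !lambdaMnl !lambdaMnr lambdaDl lambdaDr !lambda_diag ba1.
  have intMn (z : int) k : z *+ k = z * k%:Z by rewrite -mulr_natr natz.
  by rewrite !intMn -!subzn // -mulnn !PoszM; ring.
rewrite exchange_big /= /dilog_trunc !mulr_suml Defs.coef_sum.
apply: eq_bigr => i _; rewrite -mulrA mulr_suml mulr_sumr Defs.coef_sum.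
apply: eq_bigr => j _; rewrite !mulr_sumr Defs.coef_sum.
apply: eq_bigr => k _; rewrite mulrA !mono_mul coef_mono /Z /H.
have -> : b *+ i + (a + b) *+ j + a *+ k = a *+ (k + j) + b *+ (i + j).
  by rewrite mulrnDl !mulrnDr [LHS]addrC [b *+ i + _]addrCA addrA.
by rewrite -/e; ring.
Qed.

End QuantumDilogarithm.

(** * Words of dilogarithms *)

(** Integer matrices as lists of rows, in a form in which whole mutation
    sequences can be evaluated. *)
Definition table := seq (seq int).

Definition mget (T : table) (i j : nat) : int := nth 0 (nth [::] T i) j.

Definition mbuild (n : nat) (f : nat -> nat -> int) : table :=
  [seq [seq f i j | j <- iota 0 n] | i <- iota 0 n].

Lemma mget_build n f i j : (i < n)%N -> (j < n)%N -> mget (mbuild n f) i j = f i j.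
Proof.
by move=> iN jN; rewrite /mget !(nth_map 0%N) ?size_iota // !nth_iota.
Qed.

Definition isum (F : nat -> int) (s : seq nat) : int :=
  foldr (fun i z => F i + z) 0 s.

Lemma isumE F s : isum F s = \sum_(i <- s) F i.
Proof. by elim: s => [|i s IHs] /=; rewrite ?big_nil // big_cons -IHs. Qed.

Definition lamt n (T : table) (a b : seq nat) : int :=
  isum (fun i => isum (fun j =>
    (nth 0%N a i)%:Z * (nth 0%N b j)%:Z * - mget T i j) (iota 0 n)) (iota 0 n).

(** The letter (s, a) stands for E(Y^a) if s is true and for its inverse
    otherwise. *)
Definition letter : Type := bool * seq nat.

Definition addv n (a b : seq nat) : seq nat :=
  [seq (nth 0 a i + nth 0 b i)%N | i <- iota 0 n].

Section Words.
Variables (n : nat) (T : table).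

(** The only applicable move on the first two letters x and y.  If they commute,
    they are exchanged, or cancelled if they are inverse to each other.  Between
    positive letters, lambda = 1 calls for the pentagon relation from left to
    right.  It applies from right to left to words b, a + b, a, for which
    lambda(b, a + b) = -1. *)
Definition flip_head (x y : letter) (w : seq letter) : seq letter :=
  let l := lamt n T x.2 y.2 in
  if l == 0 then
    if (x.1 != y.1) && (x.2 == y.2) then w else y :: x :: w
  else if x.1 && y.1 then
    if l == 1 then [:: y, (true, addv n x.2 y.2), x & w]
    else if w is z :: w' then
      if [&& l == -1, z.1 & y.2 == addv n x.2 z.2] then z :: x :: w'
      else x :: y :: w
    else x :: y :: w
  else x :: y :: w.

Fixpoint flip (w : seq letter) (p : nat) : seq letter :=
  match p, w with
  | 0, x :: y :: w' => flip_head x y w'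
  | p'.+1, x :: w' => x :: flip w' p'
  | _, _ => w
  end.

(** If C is a union of components of the quiver of B, the letters supported in C
    commute with those supported outside of C, and the two subwords can be
    treated separately. *)
Definition touches (C : seq nat) (l : letter) : bool :=
  has (fun i => nth 0%N l.2 i != 0%N) C.

Definition separated (C : seq nat) (w : seq letter) : bool :=
  all (fun x => all (fun y => lamt n T x.2 y.2 == 0) [seq l <- w | touches C l])
    [seq l <- w | ~~ touches C l].

Definition same_by (C : seq nat) (f1 f2 b1 b2 : seq nat) (w w' : seq letter) : bool :=
  [&& separated C w, separated C w',
      foldl flip [seq l <- w | touches C l] f1
        == foldl flip [seq l <- w' | touches C l] b1
    & foldl flip [seq l <- w | ~~ touches C l] f2
        == foldl flip [seq l <- w' | ~~ touches C l] b2].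

End Words.

(** [code] numbers the elements of R in the order in which [enum] lists them, so
    that sums and quantifiers over R become those over an initial segment of
    nat. *)
Section Coordinates.
Variables (R : finType) (n : nat) (code : R -> nat).
Hypothesis codeE : [seq code x | x <- enum R] = iota 0 n.

Lemma code_lt x : (code x < n)%N.
Proof.
have : code x \in [seq code x | x <- enum R] by rewrite map_f ?mem_enum.
by rewrite codeE mem_iota.
Qed.

Lemma code_inj : injective code.
Proof.
have /(injectiveP _) : dinjectiveb code R; last by [].
by rewrite /dinjectiveb /= codeE iota_uniq.
Qed.

Lemma sum_code (V : nmodType) (F : nat -> V) :
  \sum_x F (code x) = \sum_(i <- iota 0 n) F i.
Proof. by rewrite -codeE big_map big_enum. Qed.

Lemma forall_code (p : pred nat) : [forall x, p (code x)] = all p (iota 0 n).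
Proof.
rewrite -codeE all_map; apply/forallP/allP => [pc x _|pc x]; first exact: pc.
by apply: pc; rewrite mem_enum.
Qed.

Definition vec (v : seq nat) : {ffun R -> nat} := [ffun x => nth 0%N v (code x)].

Lemma vec_addv a b : vec (addv n a b) = vec a + vec b.
Proof.
apply/ffunP => x; rewrite !ffunE /addv (nth_map 0%N) ?size_iota ?code_lt //.
by rewrite nth_iota ?code_lt.
Qed.

Section WordValue.
Variables (B : R -> R -> int) (T : table).
Hypothesis Bskew : forall x y, B x y = - B y x.
Hypothesis BT : forall x y, B x y = mget T (code x) (code y).

Lemma lamtE a b : lamt n T a b = lambda B (vec a) (vec b).
Proof.
rewrite /lamt isumE -sum_code; apply: eq_bigr => x _.
by rewrite isumE -sum_code; apply: eq_bigr => y _; rewrite !ffunE BT.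
Qed.

Definition letter_val (l : letter) : qaff B :=
  if l.1 then dilog_mono B (vec l.2) else (dilog_mono B (vec l.2))^-1.

Definition word_val (w : seq letter) : qaff B := \prod_(l <- w) letter_val l.

Lemma letter_val_comm x y : lamt n T x.2 y.2 = 0 ->
  letter_val x * letter_val y = letter_val y * letter_val x.
Proof.
rewrite lamtE => /(dilog_mono_comm Bskew) xy; rewrite /letter_val.
have xVy := commr_sym (commrV (commr_sym xy)).
case: x.1; case: y.1.
exact: xy.
exact: commrV xy.
exact: xVy.
exact: commrV xVy.
Qed.

(** The four outcomes are commutation, cancellation, and the two directions of
    the pentagon relation. *)
Lemma flip_head_val x y w :
  word_val (flip_head n T x y w) = word_val [:: x, y & w].
Proof.
have posE a : letter_val (true, a) = dilog_mono B (vec a) by [].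
rewrite /flip_head; case: eqP => [xy0|_].
  case: ifP => [|_]; last by rewrite /word_val !big_cons !mulrA (letter_val_comm xy0).
  case: x y {xy0} => [sx a] [sy b] /= /andP[sxy /eqP <-].
  rewrite /word_val !big_cons mulrA /letter_val /=.
  by case: sx sy sxy => [] [] // _; rewrite (mulrV, mulVr) ?dilog_mono_unit ?mul1r.
case: x y => [[] a] [[] b] //=; case: eqP => [ab1|_].
  rewrite /word_val !big_cons !mulrA !posE vec_addv -(pentagon Bskew) //.
  by rewrite -lamtE.
case: w => // [[[] d] w] /=; rewrite ?andbF //; case: ifP => // /andP[/eqP ab /eqP bE].
rewrite /word_val !big_cons !mulrA !posE.
have ad : lambda B (vec a) (vec d) = -1.
  by have := ab; rewrite lamtE bE vec_addv lambdaDr lambda_diag ?add0r.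
rewrite (pentagon Bskew); last by rewrite lambda_skew // ad opprK.
by rewrite bE vec_addv [vec d + _]addrC.
Qed.

Lemma flip_val w p : word_val (flip n T w p) = word_val w.
Proof.
elim: p w => [|p IHp] [|x w] //=; first by case: w => // y w; apply: flip_head_val.
by rewrite /word_val !big_cons -!/(word_val _) IHp.
Qed.

Lemma flips_val w s : word_val (foldl (flip n T) w s) = word_val w.
Proof. by elim: s w => //= p s IHs w; rewrite IHs flip_val. Qed.

Lemma separated_val C w : separated n T C w ->
  word_val w = word_val [seq l <- w | touches C l] * word_val [seq l <- w | ~~ touches C l].
Proof.
elim: w => [|x w IHw]; first by rewrite /word_val !big_nil mulr1.
rewrite /separated /= [word_val (x :: w)]big_cons -/(word_val w).
case: ifP => xC /= sep.
  rewrite [word_val (x :: _)]big_cons -mulrA -IHw //.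
  by apply: sub_all sep => y /= /andP[].
case/andP: sep => x_comm /IHw ->; rewrite [word_val (x :: _)]big_cons !mulrA.
congr (_ * _); elim: [seq l <- w | touches C l] x_comm => [|y s IHs] /=.
  by rewrite /word_val big_nil mulr1 mul1r.
case/andP=> /eqP xy /IHs {IHs} xs.
by rewrite /word_val big_cons -/(word_val s) mulrA letter_val_comm // -mulrA xs mulrA.
Qed.

Lemma same_by_val C f1 f2 b1 b2 w w' : same_by n T C f1 f2 b1 b2 w w' ->
  word_val w = word_val w'.
Proof.
case/and4P=> /separated_val -> /separated_val -> /eqP in_eq /eqP out_eq.
congr (_ * _).
  by rewrite -[LHS](flips_val _ f1) in_eq flips_val.
by rewrite -[LHS](flips_val _ f2) out_eq flips_val.
Qed.
End WordValue.
End Coordinates.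

(** * Mutations on tables *)

(** A relabeling by nu is given by the list of the numbers of nu^-1 x, since the
    new seed at x is the old one at nu^-1 x. *)
Inductive tab_op := TMut of nat | TRelabel of seq nat.

Definition tab_seed : Type := table * table.

Section TableSeeds.
Variable n : nat.

(** Num.min 0 (y k j) is the exponent of y_j in the tropical sum 1 + y_k. *)
Definition tab_mut (k : nat) (s : tab_seed) : tab_seed :=
  let b := mget s.1 in let y := mget s.2 in
  (mbuild n (fun i j => if (i == k) || (j == k) then - b i j
     else b i j + pospart (- b i k) * b k j + b i k * pospart (b k j)),
   mbuild n (fun i j => if i == k then - y k j
     else y i j + y k j * pospart (b k i) - Num.min 0 (y k j) * b k i)).

Definition tab_relabel (l : seq nat) (s : tab_seed) : tab_seed :=
  (mbuild n (fun i j => mget s.1 (nth 0%N l i) (nth 0%N l j)),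
   mbuild n (fun i j => mget s.2 (nth 0%N l i) j)).

Definition tab_apply (s : tab_seed) (o : tab_op) : tab_seed :=
  match o with TMut k => tab_mut k s | TRelabel l => tab_relabel l s end.

Definition tab_letter (s : tab_seed) (k : nat) : letter :=
  (all (fun j => 0 <= mget s.2 k j) (iota 0 n),
   [seq `|mget s.2 k j|%N | j <- iota 0 n]).

Fixpoint tab_word (s : tab_seed) (ops : seq tab_op) : seq letter :=
  if ops is o :: ops' then
    (if o is TMut k then cons (tab_letter s k) else id)
      (tab_word (tab_apply s o) ops')
  else [::].

Definition tab_nonpos (s : tab_seed) : bool :=
  all (fun i => all (fun j => mget s.2 i j <= 0) (iota 0 n)) (iota 0 n).

End TableSeeds.

Section Represents.
Variables (R : finType) (n : nat) (code : R -> nat).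
Hypothesis codeE : [seq code x | x <- enum R] = iota 0 n.

Definition represents (t : tab_seed) (s : Yseed R (Trop R)) : Prop :=
  (forall x y, sB s x y = mget t.1 (code x) (code y)) /\
  (forall x y, (sy s x : {ffun R -> int}) y = mget t.2 (code x) (code y)).

Definition tab_of_op (o : op R) : tab_op :=
  match o with
  | Mut k => TMut (code k)
  | Relabel nu => TRelabel [seq code ((nu^-1)%g x) | x <- enum R]
  end.

Let code_lt := code_lt codeE.
Let code_inj := code_inj codeE.

Lemma nth_code (T : Type) (x0 : T) (f : R -> T) x :
  nth x0 [seq f y | y <- enum R] (code x) = f x.
Proof.
have nE : #|R| = n by rewrite cardE -(size_iota 0 n) -codeE size_map.
have xR : (code x < #|R|)%N by rewrite nE code_lt.
rewrite (nth_map x) -?cardE //; congr f; apply: code_inj.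
rewrite -(nth_map x 0%N code) -?cardE // codeE nth_iota ?code_lt //.
Qed.

Lemma ffunMzE (f : {ffun R -> int}) (z : int) x : (f *~ z) x = f x * z.
Proof.
by case: z => k; rewrite -mulrzz /intmul ?ffunE ffunMnE.
Qed.

Lemma represents_apply t s o : represents t s ->
  represents (tab_apply n t (tab_of_op o)) (apply_op s o).
Proof.
case=> tB ty; case: o => [k|nu]; split=> x y /=; rewrite mget_build ?code_lt //.
- by rewrite /mutB !tB !(inj_eq code_inj).
- rewrite /muty (inj_eq code_inj) -!ty -!tB; case: eqP => _.
    by rewrite ffunE.
  rewrite !ffunE !ffunMzE !ffunE; ring.
- by rewrite tB !nth_code.
- by rewrite ty !nth_code.
Qed.

Lemma represents_run t s ops : represents t s ->
  represents (foldl (tab_apply n) t (map tab_of_op ops)) (run s ops).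
Proof.
elim: ops t s => //= o ops IHops t s ts.
exact/IHops/represents_apply.
Qed.

Lemma represents_nonpos t s : represents t s ->
  [forall x, forall y, (sy s x : {ffun R -> int}) y <= 0] = tab_nonpos n t.
Proof.
case=> _ ty; rewrite /tab_nonpos -(forall_code codeE).
apply: eq_forallb => x; rewrite -(forall_code codeE).
by apply: eq_forallb => y; rewrite ty.
Qed.

Lemma represents_letter (B : R -> R -> int) t s k : represents t s ->
  dilog_factor B (sy s k) = letter_val code B (tab_letter n t (code k)).
Proof.
case=> _ ty; rewrite /dilog_factor /letter_val /tab_letter /=.
have -> : vec code [seq `|mget t.2 (code k) j|%N | j <- iota 0 n] = tropabs (sy s k).
  apply/ffunP => x; rewrite !ffunE (nth_map 0%N) ?size_iota ?code_lt //.
  by rewrite nth_iota ?code_lt // -ty.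
rewrite /tropsign -(forall_code codeE) (eq_forallb (fun y => congr1 _ (ty k y))).
by case: ifP.
Qed.

Lemma represents_word (B : R -> R -> int) t s ops : represents t s ->
  EE B s ops = word_val code B (tab_word n t (map tab_of_op ops)).
Proof.
elim: ops t s => [|o ops IHops] t s ts; first by rewrite /word_val big_nil.
rewrite /= (IHops _ _ (represents_apply o ts)); case: o => [k|nu] /=.
  by rewrite /word_val big_cons -(represents_letter B k ts).
by rewrite mul1r.
Qed.

End Represents.

(** * Pairs of rank two *)

(** The vertices (0, p) are numbered by p, the vertices (1, p) by r0 + p.  The
    entry p of the list at i, j in t is n_{ij;p}. *)
Section RankTwoTables.
Variables (r0 r1 : nat) (t : seq (seq (seq int))).

Let n := (r0 + r1)%N.

Definition tab_n (i j p : nat) : int := nth 0 (nth [::] (nth [::] t i) j) p.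

Definition row_of (c : nat) : nat := (r0 <= c)%N.
Definition pos_of (c : nat) : nat := if (r0 <= c)%N then (c - r0)%N else c.

Definition tab_nZ (i j p q : nat) : int :=
  if (q <= p)%N then tab_n i j (p - q) else 0.

Definition tab_B : table := mbuild n (fun c d =>
  let: (i, p) := (row_of c, pos_of c) in let: (j, q) := (row_of d, pos_of d) in
  - tab_nZ i j p q + tab_nZ j i q p
  + isum (fun k => isum (fun v =>
      pospart (tab_n i k (p - v)) * pospart (- tab_n j k (q - v))
      - pospart (- tab_n i k (p - v)) * pospart (tab_n j k (q - v)))
      (iota 0 (minn p q).+1)) (iota 0 2)).

Definition tab_init : tab_seed := (tab_B, mbuild n (fun i j => (j == i)%:R)).

Definition tab_mut_bfi : seq tab_op :=
  [seq TMut c | c <- iota 0 n & (c == 0%N) || (c == r0)].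

Definition next_code (c : nat) : nat :=
  if c.+1 == r0 then 0%N else if c.+1 == n then r0 else c.+1.

Definition prev_code (c : nat) : nat :=
  if c == 0%N then r0.-1 else if c == r0 then n.-1 else c.-1.

Definition tab_fwd : seq tab_op :=
  rcons tab_mut_bfi (TRelabel [seq next_code c | c <- iota 0 n]).

Definition tab_bwd : seq tab_op :=
  TRelabel [seq prev_code c | c <- iota 0 n] :: tab_mut_bfi.

Definition tab_all_nonpos (ops : seq tab_op) (u : nat) : bool :=
  tab_nonpos n (foldl (tab_apply n) tab_init (flatten (nseq u ops))).

Definition is_height (ops : seq tab_op) (h : nat) : bool :=
  [&& (0 < h)%N, tab_all_nonpos ops h
    & all (fun u => ~~ tab_all_nonpos ops u) (iota 1 h.-1)].

(** Besides the claimed values of h_+ and h_-, the positions f1, f2 (for the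
    forward word) and b1, b2 (for the backward word) of the moves inside and
    outside of the set of vertices C. *)
Definition certified (hp hm : nat) (C f1 f2 b1 b2 : seq nat) : bool :=
  [&& is_height tab_fwd hp, is_height tab_bwd hm
    & same_by n tab_B C f1 f2 b1 b2
        (tab_word n tab_init (flatten (nseq hp tab_fwd)))
        (tab_word n tab_init (flatten (nseq hm tab_bwd)))].

End RankTwoTables.

Lemma isum_ord (F : nat -> int) m : \sum_(k < m) F k = isum F (iota 0 m).
Proof. by rewrite isumE -(big_mkord xpredT F) /index_iota subn0. Qed.

Lemma least_pos_eq (Q : pred nat) h : (0 < h)%N -> Q h ->
  all (fun u => ~~ Q u) (iota 1 h.-1) -> least_pos Q = h.
Proof.
move=> h0 Qh /allP notQ; rewrite /least_pos; case: pselect => [ex|[]]; last first.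
  by exists h; rewrite h0.
case: ex_minnP => u /andP[u0 Qu] u_min; apply/eqP; rewrite eqn_leq.
rewrite u_min ?h0 //= leqNgt; apply/negP => uh.
by have := notQ u; rewrite mem_iota Qu; lia.
Qed.

Section RankTwo.
Variables (P : Y0 2) (r0 r1 : nat) (t : seq (seq (seq int))).
Hypothesis hr0 : rr P ord0 = r0.
Hypothesis hr1 : rr P ord_max = r1.
Hypothesis hn : forall i j p, nn P i j p = tab_n t i j p.

Let n := (r0 + r1)%N.

Definition code (x : RR P) : nat := ((if ri x == ord0 then 0 else r0) + rp x)%N.

Lemma code_pos (x : RR P) :
  [/\ (rp x < rr P (ri x))%N, row_of r0 (code x) = ri x & pos_of r0 (code x) = rp x].
Proof.
have xr : (rp x < rr P (ri x))%N := ltn_ord (tagged x).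
rewrite /code /row_of /pos_of; move: xr; case: (ri x) => -[|[|i]] //= i2.
  have -> : Ordinal i2 = ord0 by apply: val_inj.
  by rewrite hr0 add0n (leqNgt r0) => xr; rewrite xr.
by rewrite leq_addr addKn.
Qed.

Lemma rrE (i : 'I_2) : rr P i = if i == ord0 then r0 else r1.
Proof.
case: i => -[|[|i]] // i2.
  by rewrite -hr0; congr rr; apply: val_inj.
by rewrite -hr1; congr rr; apply: val_inj.
Qed.

(** The enumeration of the dependent pairs (i, p) lists those with i = 0 first,
    and each group in the order of p. *)
Lemma codeE : [seq code x | x <- enum (RR P)] = iota 0 n.
Proof.
rewrite enumT [in LHS]unlock /= /tag_enum -enumT.
rewrite enum_ordSl enum_ordSl enum_ord0 /= cats0 map_cat -!map_comp.
rewrite iotaD; congr (_ ++ _).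
  by rewrite -hr0 -val_enum_ord -enumT; apply: eq_map => p.
have -> : lift ord0 ord0 = ord_max :> 'I_2 by apply: val_inj.
rewrite -hr1 add0n -[r0]addn0 iotaDl -val_enum_ord -map_comp -enumT.
by apply: eq_map => p.
Qed.

Lemma nnZE i j (p q : nat) : nnZ P i j (p%:Z - q%:Z) = tab_nZ t i j p q.
Proof.
rewrite /tab_nZ; case: leqP => [qp|pq]; first by rewrite subzn //= hn.
have -> : p%:Z - q%:Z = Negz (q - p).-1 by lia.
by [].
Qed.

Lemma tab_BE x y : BB x y = mget (tab_B r0 r1 t) (code x) (code y).
Proof.
rewrite mget_build ?(code_lt codeE) //.
have [_ -> ->] := code_pos x; have [_ -> ->] := code_pos y.
rewrite /BB !nnZE -isum_ord; congr (_ + _); apply: eq_bigr => k _.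
by rewrite -isum_ord; apply: eq_bigr => v _; rewrite /nplus /nminus !hn.
Qed.

Lemma represents_init : represents code (tab_init r0 r1 t) (init P).
Proof.
split=> x y; first exact: tab_BE.
by rewrite mget_build ?(code_lt codeE) // ffunE (inj_eq (code_inj codeE)).
Qed.

Lemma code_bfi : [seq tab_of_op code o | o <- [seq Mut k | k <- enum (bfi P)]]
  = tab_mut_bfi r0 r1.
Proof.
rewrite /tab_mut_bfi -/n -codeE filter_map -!map_comp; congr map.
rewrite [in RHS]enumT {1}/enum_mem; apply: eq_filter => x; rewrite inE /= inE /code.
have [] := code_pos x; rewrite rrE; case: eqP => _ xr _ _; first by lia.
by have := rr_ge1 P ord0; rewrite hr0; lia.
Qed.

Lemma code_nuf x : code (nuf x) = prev_code r0 r1 (code x).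
Proof.
have -> : code (nuf x) = ((if ri x == ord0 then 0 else r0)
    + (rp x + rr P (ri x)).-1 %% rr P (ri x))%N by [].
have [xr _ _] := code_pos x; move: xr; rewrite /code /prev_code rrE.
have r0_gt0 : (0 < r0)%N by rewrite -hr0 rr_ge1.
have predE p r : (p < r)%N -> ((p + r).-1 %% r = if p == 0 then r.-1 else p.-1)%N.
  by case: p => [|p] pr; rewrite ?addSn /= ?modnDr modn_small //; lia.
by case: (ri x == ord0) => xr; rewrite predE //; do !case: eqP => *; lia.
Qed.

Lemma next_prev_code c : (0 < r0)%N -> (0 < r1)%N -> (c < n)%N ->
  next_code r0 r1 (prev_code r0 r1 c) = c.
Proof.
rewrite /next_code /prev_code /n => r0_gt0 r1_gt0 cn.
by case: (c =P 0%N) => c0; [|case: (c =P r0) => cr]; do !case: eqP => *; lia.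
Qed.

Lemma code_nuV x : code ((nu P)^-1%g x) = next_code r0 r1 (code x).
Proof.
rewrite -{2}(permKV (nu P) x); move: ((nu P)^-1%g x) => y.
rewrite permE code_nuf next_prev_code //.
- by rewrite -hr0 rr_ge1.
- by rewrite -hr1 rr_ge1.
- exact: code_lt codeE _.
Qed.

Lemma code_fwd : map (tab_of_op code) (fwd P) = tab_fwd r0 r1.
Proof.
rewrite /fwd map_rcons code_bfi /= /tab_fwd -/n -codeE -map_comp.
by congr (rcons _ (TRelabel _)); apply: eq_map => x; rewrite code_nuV.
Qed.

Lemma code_bwd : map (tab_of_op code) (bwd P) = tab_bwd r0 r1.
Proof.
rewrite /bwd /= code_bfi /= /tab_bwd -/n -codeE -map_comp.
by congr (TRelabel _ :: _); apply: eq_map => x; rewrite /= invgK permE code_nuf.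
Qed.

Lemma map_flatten_nseq (S S' : Type) (f : S -> S') s u :
  map f (flatten (nseq u s)) = flatten (nseq u (map f s)).
Proof. by rewrite map_flatten map_nseq. Qed.

Lemma code_mupow (u : nat) :
  (map (tab_of_op code) (mupow P u%:Z) = flatten (nseq u (tab_fwd r0 r1)))
  * (map (tab_of_op code) (mupow P (- u%:Z)) = flatten (nseq u (tab_bwd r0 r1))).
Proof.
split; first by rewrite /mupow map_flatten_nseq code_fwd.
by case: u => // u; rewrite -NegzE /mupow map_flatten_nseq code_bwd.
Qed.

Lemma tab_all_nonposE (u : int) (ops : seq tab_op) k :
  map (tab_of_op code) (mupow P u) = flatten (nseq k ops) ->
  all_nonpos P u = tab_all_nonpos r0 r1 t ops k.
Proof.
move=> opsE; rewrite /all_nonpos /yy /tab_all_nonpos -opsE.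
exact/(represents_nonpos codeE)/(represents_run codeE)/represents_init.
Qed.

Lemma height_eq (Q : pred nat) ops h : Q =1 tab_all_nonpos r0 r1 t ops ->
  is_height r0 r1 t ops h -> least_pos Q = h.
Proof.
move=> QE /and3P[h0 Qh /allP notQ]; apply: least_pos_eq => //; first by rewrite QE.
by apply/allP => u /notQ; rewrite QE.
Qed.

(** The hypotheses on the pair determine B and both words, so that what is left is
    a boolean test on tables. *)
Lemma EEmu_eq hp hm C f1 f2 b1 b2 :
  certified r0 r1 t hp hm C f1 f2 b1 b2 ->
  EEmu P (hplus P)%:Z = EEmu P (- (hminus P)%:Z).
Proof.
case/and3P=> hpP hmP same.
have -> : hplus P = hp.
  apply: height_eq hpP => u.
  exact/tab_all_nonposE/(code_mupow u).1.
have -> : hminus P = hm.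
  apply: height_eq hmP => u.
  exact/tab_all_nonposE/(code_mupow u).2.
rewrite /EEmu !(represents_word codeE _ _ represents_init) !code_mupow.
exact: (same_by_val codeE (@BB_skew _ P) tab_BE same).
Qed.

End RankTwo.

(** * The six pairs *)

Lemma Aplus_entry (m : nat) (P : Y0 m) i j :
  Aplus P i j = (1 + 'X^(rr P i)) *+ (i == j) - \poly_(p < rr P i) nplus P i j p.
Proof. by rewrite !mxE. Qed.

Lemma Aminus_entry (m : nat) (P : Y0 m) i j :
  Aminus P i j = (1 + 'X^(rr P i)) *+ (i == j) - \poly_(p < rr P i) nminus P i j p.
Proof. by rewrite !mxE. Qed.

(** The polynomials n^+_{ii} have degree below r_i, so that r_i can be read off
    the degree of the i-th diagonal entry. *)
Lemma size_Aplus (m : nat) (P : Y0 m) i : size (Aplus P i i) = (rr P i).+1.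
Proof.
have r_gt0 := rr_ge1 P i.
have size_top : size (1 + 'X^(rr P i) : {poly int}) = (rr P i).+1.
  by rewrite addrC size_polyDl size_polyXn // size_poly1.
rewrite Aplus_entry eqxx mulr1n size_polyDl ?size_top //.
by rewrite size_polyN ltnS size_poly.
Qed.

(** A_- - A_+ has the entries n^+ - n^-, which are the n_{ij;p}. *)
Lemma nn_coef (m : nat) (P : Y0 m) i j p :
  nn P i j p = (Aminus P i j - Aplus P i j)`_p.
Proof.
have subBB (x y z : {poly int}) : x - y - (x - z) = z - y by ring.
rewrite Aplus_entry Aminus_entry subBB coefB !coef_poly.
case: ltnP => [_|pr]; first by rewrite /nplus /nminus /pospart; lia.
by rewrite nn_supp ?subrr // negb_and -(leqNgt (rr P i)) pr orbT.
Qed.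

Lemma size_by_coef (p : {poly int}) k :
  p`_k != 0 -> (forall l, p`_(k.+1 + l) = 0) -> size p = k.+1.
Proof.
move=> pk p_high; apply/eqP; rewrite eqn_leq; apply/andP; split.
  by apply/leq_sizeP => l kl; rewrite -(subnKC kl).
by rewrite ltnNge; apply: contra pk => /leq_sizeP ->.
Qed.

Lemma EEmu_eq_of_pair (P : Y0 2) (a b c d a' b' c' d' : {poly int})
    (r0 r1 : nat) (t : seq (seq (seq int)))
    (hp hm : nat) (C f1 f2 b1 b2 : seq nat) :
  certified r0 r1 t hp hm C f1 f2 b1 b2 ->
  size a = r0.+1 -> size d = r1.+1 ->
  (forall p, [/\ (a' - a)`_p = tab_n t 0 0 p, (b' - b)`_p = tab_n t 0 1 p,
    (c' - c)`_p = tab_n t 1 0 p & (d' - d)`_p = tab_n t 1 1 p]) ->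
  (Aplus P, Aminus P) = (mx22 a b c d, mx22 a' b' c' d') ->
  EEmu P (hplus P)%:Z = EEmu P (- (hminus P)%:Z).
Proof.
move=> cert sa sd tE [AP AM]; apply: EEmu_eq cert.
- by have := size_Aplus P ord0; rewrite AP mxE /= sa => -[].
- by have := size_Aplus P ord_max; rewrite AP mxE /= sd => -[].
move=> i j p; rewrite nn_coef AP AM !mxE.
have [t00 t01 t10 t11] := tE p.
by case: i j => [[|[|i]] i2] [[|[|j]] j2].
Qed.

Theorem corollary2p10 (P : Y0 2) (hY : inY P)
    (hP : (Aplus P, Aminus P) \in six_pairs) :
  EEmu P ((hplus P)%:Z) = EEmu P (- (hminus P)%:Z).
Proof.
(* In the first three pairs the quiver of B has two components, according to the
   parity of i + u for vertices (i, u); C is the even one.  In the others C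
   contains all vertices.  The positions come from a breadth-first search for a
   shortest path of pentagon moves between words up to commutation. *)
move: hP; rewrite !inE; case/or4P=> [/eqP|/eqP|/eqP|/or3P[]/eqP].
- apply: (@EEmu_eq_of_pair _ _ _ _ _ _ _ _ _ 2 2
    [:: [:: [::]; [:: 0; 1]]; [:: [:: 0; 1]; [::]]] 3 2
    [:: 0; 3]%N [:: 0]%N [:: 0]%N [::] [::]).
  + by vm_compute.
  + by apply: size_by_coef => [|l]; rewrite !coefE.
  + by apply: size_by_coef => [|l]; rewrite !coefE.
  by case; do 11?[case]; split; rewrite !coefE.
(* The backward words of the second and the third pair contain factors E(a)^-1,
   each of which is cancelled by moving the preceding E(a) next to it; these
   are the moves b1 and b2. *)
- apply: (@EEmu_eq_of_pair _ _ _ _ _ _ _ _ _ 2 6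
    [:: [:: [::]; [:: 0; 1]]; [:: [:: 0; 1; 0; -1; 0; 1]; [::]]] 8 6
    [:: 0; 3; 5; 7]%N
    [:: 0; 3; 1; 4; 2; 3; 2; 0; 1; 0; 2]%N
    [:: 1; 4; 0; 3; 1; 2; 1; 3; 2; 0; 1]%N
    [:: 1; 3]%N [:: 0; 2]%N).
  + by vm_compute.
  + by apply: size_by_coef => [|l]; rewrite !coefE.
  + by apply: size_by_coef => [|l]; rewrite !coefE.
  by case; do 11?[case]; split; rewrite !coefE.
- apply: (@EEmu_eq_of_pair _ _ _ _ _ _ _ _ _ 2 10
    [:: [:: [::]; [:: 0; 1]]; [:: [:: 0; 1; 0; -1; 0; 1; 0; -1; 0; 1]; [::]]] 18 10
    [:: 0; 3; 5; 7; 9; 11]%N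
    [:: 0; 3; 6; 9; 10; 11; 9; 4; 8; 7; 5; 6; 2; 3; 4; 5; 9; 8; 6; 4; 2; 7; 3;
        4; 5; 9; 8; 6; 1; 5; 4; 2; 3; 2; 0; 4; 7; 5; 6; 1; 2; 5; 3; 0; 4; 3; 5]%N
    [:: 1; 4; 7; 10; 11; 12; 10; 5; 9; 8; 6; 0; 5; 4; 3; 1; 6; 3; 4; 5; 9; 8; 6;
        3; 7; 2; 6; 5; 3; 1; 4; 3; 2; 0; 7; 6; 5; 3; 5; 4; 6; 5; 1; 2; 3; 4]%N
    [:: 1; 3; 4; 6]%N [:: 0; 2; 3; 5]%N).
  + by vm_compute.
  + by apply: size_by_coef => [|l]; rewrite !coefE.
  + by apply: size_by_coef => [|l]; rewrite !coefE.
  by case; do 11?[case]; split; rewrite !coefE.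
- apply: (@EEmu_eq_of_pair _ _ _ _ _ _ _ _ _ 2 2
    [:: [:: [:: 0; -1]; [:: 0; 1]]; [:: [:: 0; 1]; [:: 0; -1]]] 3 3
    [:: 0; 1; 2; 3]%N [:: 2; 1; 5; 3; 4; 3; 2; 0; 2; 1; 3; 0]%N [::] [::] [::]).
  + by vm_compute.
  + by apply: size_by_coef => [|l]; rewrite !coefE.
  + by apply: size_by_coef => [|l]; rewrite !coefE.
  by case; do 11?[case]; split; rewrite !coefE.
- apply: (@EEmu_eq_of_pair _ _ _ _ _ _ _ _ _ 2 3
    [:: [:: [:: 0; -1]; [:: 0; 1]]; [:: [:: 0; 1; 1]; [::]]] 5 3
    [:: 0; 1; 2; 3; 4]%N
    [:: 0; 1; 3; 4; 8; 7; 5; 2; 3; 5; 6; 2; 3; 4; 3; 2; 0; 1; 4; 2; 3; 4]%N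
    [::] [::] [::]).
  + by vm_compute.
  + by apply: size_by_coef => [|l]; rewrite !coefE.
  + by apply: size_by_coef => [|l]; rewrite !coefE.
  by case; do 11?[case]; split; rewrite !coefE.
- apply: (@EEmu_eq_of_pair _ _ _ _ _ _ _ _ _ 2 2
    [:: [:: [::]; [:: 0; 1]]; [:: [:: 0; 1]; [:: 0; 1]]] 5 2
    [:: 0; 1; 2; 3]%N [:: 2; 3; 4; 3; 1; 3; 4; 2; 3; 2; 0; 1; 0]%N
    [::] [::] [::]).
  + by vm_compute.
  + by apply: size_by_coef => [|l]; rewrite !coefE.
  + by apply: size_by_coef => [|l]; rewrite !coefE.
  by case; do 11?[case]; split; rewrite !coefE.
Qed.
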